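(* Let $A\geq 2$ be an integer, let $C:=\pi\sqrt{2/3}$, and for real $x$ and positive integers $n$ let $$k_{A,n}=k_{A,n}(x):=\frac{1}{AC}\sqrt{n}\log(n)+x\sqrt{n}.$$ Then for every real number $x$, $$ \lim_{n\rightarrow +\infty}\frac{p_{\leq k_{A,n}}(A;n)}{p(n)}=\exp\left(-\frac{2}{AC}\exp\left(-\frac12 xAC\right)\right). $$
   Context: $p(n)$ denotes the number of integer partitions of $n$. For an integer $A\ge 2$ and a real number $k$, $p_{\leq k}(A;n)$ denotes the number of partitions of $n$ having at most $k$ parts (counted with multiplicity) that are multiples of $A$; there is no restriction on the parts that are not multiples of $A$. *)

(* Defs.v *)
From mathcomp Require Import all_boot all_order all_algebra.
From mathcomp Require Import all_classical all_reals all_analysis.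

Set Implicit Arguments.
Unset Strict Implicit.
Unset Printing Implicit Defensive.

Import Order.TTheory GRing.Theory Num.Theory.

Local Open Scope ring_scope.

Definition is_partition (n : nat) (s : seq nat) : bool :=
  [&& sorted geq s, all (leq 1) s & sumn s == n].

(* A partition of n has at most n parts, each at most n, so the partitions of n
   are exactly the values of the finite type below; see [is_partition_bseq]. *)
Definition parts (n : nat) (s : n.-bseq 'I_n.+1) : seq nat :=
  [seq val i | i <- s].

Lemma parts_inj (n : nat) : injective (@parts n).
Proof.
by move=> s t st; apply: val_inj; exact: (inj_map val_inj st).
Qed.

Lemma is_partition_bseq (n : nat) (s : seq nat) :
  is_partition n s -> exists t : n.-bseq 'I_n.+1, parts t = s.
Proof.
case/and3P=> _ s_gt0 /eqP s_sum.
have s_size : (size s <= n)%N.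
  rewrite -s_sum; elim: s s_gt0 {s_sum} => //= a s IHs /andP[a_gt0 /IHs].
  by rewrite -add1n; exact: leq_add.
have s_le : all (fun i => i < n.+1)%N s.
  apply/allP => i i_s; rewrite ltnS -s_sum.
  elim: s i_s {s_gt0 s_sum s_size} => //= a s IHs; rewrite inE.
  case/orP => [/eqP->|/IHs]; first exact: leq_addr.
  by move/leq_trans; apply; exact: leq_addl.
have t_size : (size [seq inord i : 'I_n.+1 | i <- s] <= n)%N by rewrite size_map.
exists (Bseq t_size); rewrite /parts /= -map_comp -[RHS]map_id.
by apply/eq_in_map => i /(allP s_le) i_le /=; rewrite inordK.
Qed.

Definition p (n : nat) : nat :=
  #|[pred s : n.-bseq 'I_n.+1 | is_partition n (parts s)]|.

Definition p_le {R : realType} (k : R) (A n : nat) : nat :=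
  #|[pred s : n.-bseq 'I_n.+1 | is_partition n (parts s)
      && ((count (dvdn A) (parts s))%:R <= k)]|.

Definition C {R : realType} : R := pi * Num.sqrt (2 / 3).

Definition k {R : realType} (A n : nat) (x : R) : R :=
  (A%:R * C)^-1 * Num.sqrt n%:R * ln n%:R + x * Num.sqrt n%:R.

(* Main.v *)
Require Import Defs.
From mathcomp Require Import all_boot all_order all_algebra.
From mathcomp Require Import all_classical all_reals all_analysis.
From mathcomp Require Import zify ring lra.
Set Implicit Arguments.
Unset Strict Implicit.
Unset Printing Implicit Defensive.
Import Order.TTheory GRing.Theory Num.Theory.
Import numFieldNormedType.Exports.
Local Open Scope classical_set_scope.
Local Open Scope ring_scope.

(** Inclusion-exclusion over the parts beyond [K] that are multiples of [A] shows
    that the partitions with at most [K] multiples of [A] have the generating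
    function of all partitions times the product of the [1 - q^(j * A)] over
    [j > K] ([p_atmostS], by an explicit bijection). If [p (n - i) / p n] were
    equal to [z^i] with [z = exp (- c0 / sqrt n)] and [c0 = C / 2], the proportion
    of such partitions would be the product of the [1 - z^(j * A)] over [j > K],
    roughly the exponential of minus the sum of the [z^(j * A)]. For
    [K = k_{A,n}(x)] that geometric sum tends to
    [2 / (A * C) * exp (- x * A * C / 2)], and this is the theorem. What remains is
    to replace [p (n - i) / p n] by [z^i] uniformly for [i] of order
    [sqrt n * ln n]. The replacement ([pratio_geometric]) has a small relative
    error with respect to a slightly slower geometric sequence, and
    [p_atmost_near] transfers it to the product, factor by factor.

    All of it rests on one estimate for the relative increments
    [r n = (p n - p (n - 1)) / p n], namely
    [r n = c0 / sqrt n + O (n^(-3/4))] ([rincr_err_rate]). It is proved without an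
    asymptotic formula for [p], from the recursion
    [n * p n = sum of sigma m * p (n - m)] ([p_recursion]) alone. Put
    [E n = r n - c0 / sqrt n].

    - Subtracting the recursions at [n] and [n - 1] shows that [E n] is, up to
      [O (1 / n)], an average of the earlier [E (n - m)] with the probability
      weights [sigma m * p (n - m) / (n * p n)] ([rincr_err_average]). Averaging
      smooths the errors but preserves constants, so it cannot find [c0].

    - The sum of [sigma m * exp (- c0 * m / sqrt n)] is [n + O (sqrt n)]: this is
      the Basel sum ([zeta2_le], [zeta2_ge]), and it is what determines [c0].
      Comparing with the recursion and telescoping gives a linear combination
      of the [E (n - j)] with positive weights of total order [n^(3/2)] that is
      only [O (sqrt n)] ([rincr_err_weighted]).

    - On the scale [sqrt n] these weights are comparable with the averaging
      kernel. Subtracting a small multiple of the second relation from the first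
      leaves a kernel of total variation less than one
      ([rincr_err_contraction]), and strong induction gives the power saving.

    The a priori bounds that this needs (exponential decay of [p (n - m) / p n] in
    [m / sqrt n], and [r n = O (1 / sqrt n)]) follow from the same recursion and
    from the convexity of [p]. *)

(** * Partitions as sorted lists *)

Definition partitions (n : nat) : seq (seq nat) :=
  [seq parts t | t in [pred t : n.-bseq 'I_n.+1 | is_partition n (parts t)]].

Lemma mem_partitions n s : (s \in partitions n) = is_partition n s.
Proof.
rewrite /partitions; apply/fintype.imageP/idP => [[t]|ns]; first by rewrite inE => ? ->.
have [t ts] := is_partition_bseq ns.
by exists t; rewrite ?inE ?ts.
Qed.

Lemma partitions_uniq n : uniq (partitions n).
Proof. by rewrite map_inj_uniq ?enum_uniq//; exact: parts_inj. Qed.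

Lemma card_partitions n (P : pred (seq nat)) :
  #|[pred t : n.-bseq 'I_n.+1 | is_partition n (parts t) && P (parts t)]|
  = count P (partitions n).
Proof.
rewrite /partitions count_map cardE /enum_mem -size_filter -filter_predI.
by congr size; apply: eq_filter => t; rewrite /= !inE andbC.
Qed.

Lemma size_partitions n : size (partitions n) = p n.
Proof.
rewrite -(count_predT (partitions n)) -card_partitions /p.
by apply: eq_card => t; rewrite !inE andbT.
Qed.

Lemma p_le_count (R : realType) (x : R) A n :
  p_le x A n = count (fun s => (count (dvdn A) s)%:R <= x) (partitions n).
Proof. by rewrite -card_partitions. Qed.

Lemma leq_count_inj (T : eqType) (s1 s2 : seq T) (P1 P2 : pred T) (f : T -> T) :
  uniq s1 -> {in [pred x in s1 | P1 x], forall x, (f x \in s2) && P2 (f x)} ->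
  {in [pred x in s1 | P1 x] &, injective f} ->
  (count P1 s1 <= count P2 s2)%N.
Proof.
move=> us1 fP f_inj; rewrite -!size_filter -(size_map f).
apply: uniq_leq_size => [|y].
  rewrite map_inj_in_uniq ?filter_uniq// => x y.
  by rewrite !mem_filter andbC => /f_inj + /andP[? ?]; apply; rewrite inE; apply/andP.
case/mapP => x; rewrite mem_filter => /andP[Px xs] ->.
by rewrite mem_filter andbC; apply: fP; rewrite inE xs.
Qed.

Lemma is_partition_sort n s : all (leq 1) s -> sumn s = n -> is_partition n (sort geq s).
Proof.
move=> s_gt0 <-; have ss : perm_eq (sort geq s) s by rewrite perm_sort.
rewrite /is_partition (perm_all _ ss) s_gt0 (perm_sumn ss) eqxx !andbT.
by apply: sort_sorted => a b; exact: leq_total.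
Qed.

Lemma partition_eq n m s t : is_partition n s -> is_partition m t ->
  perm_eq s t -> s = t.
Proof.
case/and3P=> ss _ _ /and3P[st _ _]; apply: (sorted_eq (leT := geq)) => //.
  by move=> a b c /= ? ?; lia.
by move=> a b /andP[? ?] /=; lia.
Qed.

(** * Adding and removing parts *)

(** The bijection inserts one copy of [v]; sorted lists that are permutations of
    each other are equal, so it is enough to follow the multisets. *)
Lemma count_add_part v n k : (0 < v)%N ->
  count (fun s => k.+1 <= count_mem v s)%N (partitions (n + v))
  = count (fun s => k <= count_mem v s)%N (partitions n).
Proof.
move=> v0; apply/eqP; rewrite eqn_leq; apply/andP; split.
- apply: (@leq_count_inj _ _ _ _ _ (rem v)) => [|s|s t]; first exact: partitions_uniq.
    rewrite !inE !mem_partitions => /andP[/and3P[ss s_gt0 /eqP sE] vs].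
    have vin : v \in s by rewrite -has_pred1 has_count; lia.
    have /perm_sumn /= sumE := perm_to_rem vin.
    rewrite count_rem vin /= eqxx /=.
    apply/andP; split; last by rewrite subn1 -ltnS (ltn_predK vs).
    apply/and3P; split; last by apply/eqP; lia.
      apply: (subseq_sorted _ (rem_subseq v s)) => //.
      by move=> a b c /= ? ?; lia.
    by apply/allP => a /mem_rem /(allP s_gt0).
  rewrite !inE !mem_partitions => /andP[Ps vs] /andP[Pt vt] st.
  have vs' : v \in s by rewrite -has_pred1 has_count; lia.
  have vt' : v \in t by rewrite -has_pred1 has_count; lia.
  apply: (partition_eq Ps Pt); apply: perm_trans (perm_to_rem vs') _.
  by rewrite st perm_sym perm_to_rem.
- apply: (@leq_count_inj _ _ _ _ _ (fun s => sort geq (v :: s))) => [|s|s t].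
  + exact: partitions_uniq.
  + rewrite !inE !mem_partitions => /andP[/and3P[ss s_gt0 /eqP sE] vs].
    have /permP -> : perm_eq (sort geq (v :: s)) (v :: s) by rewrite perm_sort.
    rewrite is_partition_sort /= ?v0 ?eqxx//.
    by rewrite sE addnC.

  + rewrite !inE !mem_partitions => /andP[Ps vs] /andP[Pt vt] st.
    apply: (partition_eq Ps Pt); rewrite -(perm_cons v).
    apply: (@perm_trans _ (sort geq (v :: s))); first by rewrite perm_sym perm_sort.
    by rewrite st perm_sort.
Qed.

Lemma count_mult_part v n k : (0 < v)%N ->
  count (fun s => k <= count_mem v s)%N (partitions n)
  = if (k * v <= n)%N then p (n - k * v) else 0%N.
Proof.
move=> v0; elim: k n => [|k IHk] n.
  by rewrite mul0n subn0 -size_partitions -[RHS]count_predT; exact: eq_count.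
have [vn|nv] := leqP v n.
  rewrite -{1}(subnK vn) count_add_part// IHk mulSn -subnDA.
  by rewrite leq_subRL.
rewrite ifF; last by lia.
apply/eqP; rewrite -leqn0 leqNgt -has_count; apply/hasPn => s.
rewrite mem_partitions => /and3P[_ _ /eqP sE]; rewrite -leqNgt.
suff -> : count_mem v s = 0%N by [].
apply/count_memPn; apply/negP => vs; have /perm_sumn /= := perm_to_rem vs.
lia.
Qed.

Lemma p0 : p 0 = 1%N.
Proof.
rewrite -size_partitions; have : perm_eq (partitions 0) [:: [::]].
  apply: uniq_perm => //; first exact: partitions_uniq.
  move=> s; rewrite mem_partitions inE; apply/idP/eqP => [|->//].
  by case: s => // a s /and3P[_ /= /andP[+ _] /eqP]; lia.
by move/perm_size.
Qed.

Lemma leq_p_succ n : (p n <= p n.+1)%N.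
Proof.
have := @count_mult_part 1 n.+1 1 isT; rewrite mul1n subn1 /= => <-.
by rewrite -size_partitions count_size.
Qed.

Lemma leq_p m n : (m <= n)%N -> (p m <= p n)%N.
Proof. by move=> mn; apply: (homo_leq leqnn leq_trans leq_p_succ). Qed.

Lemma p_gt0 n : (0 < p n)%N.
Proof. by have := leq_p (leq0n n); rewrite p0. Qed.

Lemma p_succE n :
  p n.+1 = (p n + count (fun s => 1 \notin s)%N (partitions n.+1))%N.
Proof.
have := @count_mult_part 1 n.+1 1 isT; rewrite mul1n subn1 /= => <-.
rewrite -size_partitions -(count_predC (fun s : seq nat => 1 <= count_mem 1 s)%N).
congr addn; apply: eq_count => s /=; rewrite -leqNgt leqn0.
by apply/eqP/idP => [/count_memPn|/count_memPn].
Qed.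

(** The increment [p n.+1 - p n] is the number of partitions of [n.+1] without
    ones, and adding one to the largest part maps these injectively to the
    partitions of [n.+2] without ones. *)
Lemma p_convex n : (p n.+1 + p n.+1 <= p n + p n.+2)%N.
Proof.
rewrite {2}(p_succE n) (p_succE n.+1) addnCA leq_add2l leq_add2l.
pose f s := if s is a :: t then (a.+1 :: t : seq nat) else [::].
apply: (@leq_count_inj _ _ _ _ _ f) => [|s|s t]; first exact: partitions_uniq.
  rewrite !inE !mem_partitions; case: s => [|a s] //=.
  rewrite /is_partition /= !inE => /andP[/and3P[sp /andP[a0 s0] /eqP sE]].
  rewrite negb_or s0 => /andP[a1 s1]; apply/andP; split.
    apply/and3P; split=> //; last by apply/eqP; lia.
    by case: s sp {sE s0 s1} => //= b s /andP[ab ->]; rewrite andbT; move: ab => /=; lia.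
  by rewrite negb_or s1 andbT; lia.
rewrite !inE !mem_partitions; case: s => [|a s] /andP[/and3P[_ _ //=]].
by case: t => [|b t] //= _ _ _ [-> ->].
Qed.

(** * The divisor-sum recursion *)

Definition sigma (m : nat) : nat := (\sum_(1 <= d < m.+1 | (d %| m)%N) d)%N.

Section counting.
Local Open Scope nat_scope.

Lemma big_dvd_nat (R : Type) (idx : R) (op : Monoid.com_law idx) d N (G : nat -> R) :
  (0 < d)%N ->
  \big[op/idx]_(1 <= m < N.+1 | d %| m) G m =
  \big[op/idx]_(1 <= k < N.+1 | (k * d <= N)%N) G (k * d)%N.
Proof.
move=> d0; rewrite -big_filter -[RHS]big_filter -(big_map (muln^~ d) xpredT).
apply: perm_big; apply: uniq_perm.
- exact/filter_uniq/iota_uniq.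
- rewrite map_inj_uniq ?filter_uniq ?iota_uniq// => a b /eqP.
  by rewrite eqn_pmul2r// => /eqP.
move=> m; rewrite mem_filter mem_index_iota; apply/idP/mapP => [/andP[/dvdnP[k ->] mN]|[k]].
  exists k => //; rewrite mem_filter mem_index_iota.
  have : (k <= k * d)%N by rewrite leq_pmulr.
  by move: mN; rewrite muln_gt0; lia.
rewrite mem_filter mem_index_iota => kN ->; rewrite dvdn_mull//= muln_gt0; lia.
Qed.

Lemma big_divisors (R : Type) (idx : R) (op : Monoid.com_law idx) N
    (F : nat -> nat -> R) :
  \big[op/idx]_(1 <= m < N.+1) \big[op/idx]_(1 <= d < m.+1 | d %| m) F d m =
  \big[op/idx]_(1 <= d < N.+1) \big[op/idx]_(1 <= k < N.+1 | (k * d <= N)%N) F d (k * d)%N.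
Proof.
transitivity (\big[op/idx]_(1 <= m < N.+1) \big[op/idx]_(1 <= d < N.+1 | d %| m) F d m).
  apply: eq_big_nat => m /andP[m1 mN].
  rewrite (big_nat_widen _ _ N.+1)//; apply: congr_big_nat => // d dN.
  by rewrite andb_idr// => /dvdn_leq -/(_ m1); rewrite ltnS.
rewrite (exchange_big_dep_nat xpredT)//=; apply: eq_big_nat => d /andP[d1 _].
exact: big_dvd_nat.
Qed.

Lemma sum_count_mem n s : all (fun v => 0 < v <= n)%N s ->
  sumn s = (\sum_(1 <= v < n.+1) v * count_mem v s)%N.
Proof.
elim: s => [_|a s IHs /= /andP[an /IHs ->]]; first by rewrite big1// => v _; rewrite muln0.
rewrite [RHS](eq_bigr (fun v => v * (a == v) + v * count_mem v s)%N); last first.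
  by move=> v _; rewrite mulnDr.
have ain : a \in index_iota 1 n.+1 by rewrite mem_index_iota ltnS.
rewrite big_split/=; congr addn; rewrite (bigD1_seq a) ?iota_uniq//=.
by rewrite eqxx muln1 big1 ?addn0// => i /negPf; rewrite eq_sym => ->; rewrite muln0.
Qed.

Lemma sum_leq_nat c n : (c <= n)%N -> (\sum_(1 <= k < n.+1) (k <= c))%N = c.
Proof.
move=> cn; rewrite (big_cat_nat (n := c.+1))//=.
rewrite (eq_big_nat _ _ (F2 := fun=> 1%N)); last by move=> k /=; rewrite ltnS => /andP[_ ->].
rewrite sum_nat_const_nat muln1 subn1 /= big_nat big1 ?addn0// => k /andP[ck _].
by rewrite leqNgt ck.
Qed.

Lemma is_partition_parts n s : is_partition n s ->
  all (fun v => 0 < v <= n)%N s /\ (size s <= n)%N.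
Proof.
case/and3P=> _ + /eqP <-; elim: s => //= a s IHs /andP[a0 /IHs[s0 ss]].
split; last by lia.
apply/andP; split; first by lia.
by apply: sub_all s0 => v /andP[v0 vs]; lia.
Qed.

(** Both sides are the sum of all parts of all partitions of [n]: a part [v]
    counts once for each [k] up to its multiplicity, and the partitions in which
    [v] occurs at least [k] times are those of [n - k * v] with [k] parts added. *)
Lemma p_recursion n : (n * p n = \sum_(1 <= m < n.+1) sigma m * p (n - m))%N.
Proof.
have -> : (n * p n = \sum_(s <- partitions n) sumn s)%N.
  rewrite -size_partitions mulnC -sum1_size big_distrl /= big_seq [RHS]big_seq.
  apply: eq_bigr => s; rewrite mem_partitions => /and3P[_ _ /eqP->].
  by rewrite mul1n.
transitivity (\sum_(s <- partitions n) \sum_(1 <= v < n.+1) \sum_(1 <= k < n.+1)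
    v * (k <= count_mem v s))%N.
  rewrite big_seq [RHS]big_seq; apply: eq_bigr => s.
  rewrite mem_partitions => /is_partition_parts[s0 ss].
  rewrite (sum_count_mem s0); apply: eq_bigr => v _.
  by rewrite -big_distrr /= sum_leq_nat// (leq_trans _ ss)// count_size.
transitivity (\sum_(1 <= m < n.+1) \sum_(1 <= d < m.+1 | d %| m) d * p (n - m))%N; last first.
  by apply: eq_bigr => m _; rewrite /sigma big_distrl.
rewrite big_divisors exchange_big /=; apply: eq_big_nat => v /andP[v0 _].
rewrite exchange_big /= [RHS]big_mkcond; apply: eq_bigr => k _ /=.
rewrite -big_distrr /= (_ : \sum_(s <- _) _ =
    count (fun s => k <= count_mem v s) (partitions n)).
  by rewrite count_mult_part//; case: ifP => //; rewrite muln0.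
by rewrite -sum1_count [RHS]big_mkcond; apply: eq_bigr => s _; case: leqP.
Qed.

(** * Partitions with few multiples of [A] *)

Definition p_atmost (A K n : nat) : nat :=
  count (fun s => count (dvdn A) s <= K)%N (partitions n).

Definition lower_mult (A : nat) (s : seq nat) : seq nat :=
  [seq v <- [seq if A %| v then v - A else v | v <- s] | 0 < v]%N.

(** Inverse of [lower_mult]: the copies of [A] in front are the multiples that
    [lower_mult] reduced to zero and erased. *)
Definition raise_mult (A c : nat) (s : seq nat) : seq nat :=
  nseq (c - count (dvdn A) s) A ++ [seq if A %| v then v + A else v | v <- s]%N.

Section raise_lower.
Context (A : nat) (A0 : (0 < A)%N).

Lemma count_lower_mult s : (count (dvdn A) (lower_mult A s) <= count (dvdn A) s)%N.
Proof.
rewrite /lower_mult; elim: s => //= a s IHs; case Aa: (A %| a).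
  case: ifP => _ /=; last exact: leq_trans IHs (leq_addl _ _).
  by rewrite leq_add// leq_b1.
by case: ifP => _ /=; rewrite ?Aa.
Qed.

Lemma sumn_lower_mult s : all (leq 1) s ->
  (sumn (lower_mult A s) + count (dvdn A) s * A = sumn s)%N.
Proof.
rewrite /lower_mult; elim: s => //= a s IHs /andP[a0 /IHs IH]; case Aa: (A %| a).
  have := dvdn_leq a0 Aa; rewrite mulnDl mul1n; case: ifP => /= h; lia.
by rewrite a0 /=; lia.
Qed.

Lemma count_raise_mult c s : (count (dvdn A) s <= c)%N ->
  count (dvdn A) (raise_mult A c s) = c.
Proof.
move=> sc; rewrite /raise_mult count_cat count_nseq dvdnn mul1n count_map.
rewrite [X in (_ + X)%N](_ : _ = count (dvdn A) s) ?subnK//.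
by apply: eq_count => v /=; case: ifP => // Av; rewrite dvdn_addl.
Qed.

Lemma sumn_raise_mult c s : (count (dvdn A) s <= c)%N ->
  (sumn (raise_mult A c s) = sumn s + c * A)%N.
Proof.
move=> sc; rewrite /raise_mult sumn_cat sumn_nseq.
rewrite [X in (_ + X)%N](_ : _ = sumn s + count (dvdn A) s * A)%N; first by nia.
by elim: s {sc} => //= a s ->; case: ifP => _; nia.
Qed.

Lemma raise_multK c s : all (leq 1) s -> lower_mult A (raise_mult A c s) = s.
Proof.
move=> s0; rewrite /lower_mult /raise_mult map_cat filter_cat.
rewrite (_ : [seq v <- _ | _] = [::]) /=; last first.
  by elim: (_ - _)%N => //= m ->; rewrite dvdnn subnn.
elim: s s0 => //= a s IHs /andP[a0 /IHs ->]; case Aa: (A %| a).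
  by rewrite dvdn_addl// Aa addnK a0.
by rewrite Aa a0.
Qed.

Lemma lower_multK s : all (leq 1) s ->
  perm_eq (raise_mult A (count (dvdn A) s) (lower_mult A s)) s.
Proof.
elim: s => [_|a s IHs /= /andP[a0 /IHs]]; first by rewrite /raise_mult /=.
have := count_lower_mult s; rewrite /raise_mult /lower_mult /= => cs; case Aa: (A %| a).
  have := dvdn_leq a0 Aa; rewrite leq_eqVlt => /predU1P[<-|Alt].
    by rewrite subnn /= add1n subSn//= perm_cons.
  have -> : 0 < a - A by rewrite subn_gt0.
  have hA : A %| a - A by rewrite dvdn_sub.
  rewrite /= hA subnDl subnK ?(ltnW Alt)//.
  by move=> ps; rewrite -[X in perm_eq (_ ++ X)]cat1s perm_catCA /= perm_cons.
rewrite a0 /= Aa !add0n => ps.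
by rewrite -[X in perm_eq (_ ++ X)]cat1s perm_catCA /= perm_cons.
Qed.

Lemma perm_lower_mult s t : perm_eq s t -> perm_eq (lower_mult A s) (lower_mult A t).
Proof. by move=> st; apply/perm_filter/perm_map. Qed.

Lemma perm_raise_mult c s t : perm_eq s t -> perm_eq (raise_mult A c s) (raise_mult A c t).
Proof.
by move=> st; rewrite /raise_mult (permP st) perm_cat2l perm_map.
Qed.

(** Subtracting [A] from each of the [c] multiples of [A], where those equal to
    [A] disappear, is a bijection onto partitions of [n - c * A]. *)
Lemma count_exact_mult c n :
  count (fun s => count (dvdn A) s == c) (partitions n) =
  if (c * A <= n)%N then p_atmost A c (n - c * A) else 0%N.
Proof.
case: leqP => cn; last first.
  apply/eqP; rewrite -leqn0 leqNgt -has_count; apply/hasPn => s.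
  rewrite mem_partitions => /and3P[_ s0 /eqP sE]; apply/negP => /eqP sc.
  by have := sumn_lower_mult s0; lia.
apply/eqP; rewrite eqn_leq; apply/andP; split.
- apply: (@leq_count_inj _ _ _ _ _ (fun s => sort geq (lower_mult A s))) => [|s|s t].
  + exact: partitions_uniq.
  + rewrite !inE !mem_partitions => /andP[/and3P[ss s0 /eqP sE] /eqP sc].
    rewrite is_partition_sort.
    * by rewrite /= (permP (permEl (perm_sort _ _))) -sc count_lower_mult.
    * by apply/allP => v; rewrite mem_filter => /andP[].
    * by have := sumn_lower_mult s0; rewrite sc; lia.
  + rewrite !inE !mem_partitions => /andP[Ps /eqP sc] /andP[Pt /eqP tc] st.
    apply: (partition_eq Ps Pt).
    have [/and3P[_ s0 _] /and3P[_ t0 _]] := (Ps, Pt).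
    have stl : perm_eq (lower_mult A s) (lower_mult A t).
      by rewrite -(perm_sort geq) perm_sym -(perm_sort geq) st.
    apply: (perm_trans _ (lower_multK t0)).
    rewrite perm_sym (perm_trans _ (lower_multK s0))// sc tc.
    by rewrite perm_raise_mult// perm_sym.
- apply: (@leq_count_inj _ _ _ _ _ (fun s => sort geq (raise_mult A c s))) => [|s|s t].
  + exact: partitions_uniq.
  + rewrite !inE !mem_partitions => /andP[/and3P[ss s0 /eqP sE] sc].
    rewrite is_partition_sort.
    * by rewrite /= (permP (permEl (perm_sort _ _))) count_raise_mult.
    * rewrite /raise_mult all_cat; apply/andP; split; first by rewrite all_nseq A0 orbT.
      rewrite all_map; apply: sub_all s0 => v v0 /=; case: ifP; lia.
    * by rewrite sumn_raise_mult// sE subnK.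
  + rewrite !inE !mem_partitions => /andP[Ps sc] /andP[Pt tc] st.
    apply: (partition_eq Ps Pt).
    have [/and3P[_ s0 _] /and3P[_ t0 _]] := (Ps, Pt).
    rewrite -(raise_multK c s0) -(raise_multK c t0) perm_lower_mult//.
    by rewrite -(perm_sort geq) perm_sym -(perm_sort geq) st.
Qed.

(** In terms of generating functions: the series for [K] is [1 - q^(K.+1 * A)]
    times the series for [K.+1]. *)
Lemma p_atmostS K n : p_atmost A K.+1 n =
  (p_atmost A K n + if (K.+1 * A <= n)%N then p_atmost A K.+1 (n - K.+1 * A) else 0)%N.
Proof.
rewrite -count_exact_mult /p_atmost -count_predUI.
rewrite [X in (_ + X)%N](_ : _ = 0)%N ?addn0.
  by apply: eq_count => s /=; rewrite orbC -leq_eqVlt.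
by apply/eqP; rewrite -leqn0 leqNgt -has_count; apply/hasPn => s _ /=; lia.
Qed.

Lemma p_atmost_all K n : (n <= K)%N -> p_atmost A K n = p n.
Proof.
move=> nK; rewrite -size_partitions -[RHS]count_predT; apply: eq_in_count => s.
rewrite mem_partitions => /is_partition_parts[_ sn] /=.
by rewrite (leq_trans (count_size _ _))// (leq_trans sn).
Qed.

End raise_lower.
End counting.

(** * Elementary inequalities *)

Lemma ge0_of_derive (R : realType) (f f' : R -> R) (x : R) : 0 <= x ->
  f 0 = 0 -> (forall t : R, is_derive t (1 : R) f (f' t)) ->
  (forall t, 0 <= t <= x -> 0 <= f' t) -> 0 <= f x.
Proof.
move=> x0 f0 df f'0; have [t] := @MVT_segment R f f' 0 x x0 (fun t _ => df t)
  (derivable_within_continuous (fun t _ => @ex_derive _ _ _ _ _ _ _ (df t))).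
rewrite in_itv /= f0 !subr0 => tx ->.
by rewrite mulr_ge0// f'0.
Qed.

Lemma sinh_ge (R : realType) (u : R) : 0 <= u -> u *+ 2 <= expR u - expR (- u).
Proof.
move=> u0; rewrite -subr_ge0.
pose f (t : R) := expR t - expR (- t) - t *+ 2.
have : 0 <= f u; last by [].
apply: (@ge0_of_derive _ _ (fun t => expR t + expR (- t) - 2) u u0).
- by rewrite /f oppr0 subrr mul0rn subr0.
- move=> t; rewrite /f; apply: is_derive_eq.
  by rewrite /GRing.scale /=; lra.
- move=> t _; rewrite expRN; have := expR_gt0 t; set y := expR t => y0.
  have -> : y + y^-1 - 2 = (y - 1) ^+ 2 / y by field; rewrite gt_eqF.
  by rewrite divr_ge0 ?sqr_ge0 ?ltW.
Qed.

Lemma sinh_le (R : realType) (u : R) : 0 <= u ->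
  expR u - expR (- u) <= u * (expR u + expR (- u)).
Proof.
move=> u0; rewrite -subr_ge0.
pose f (t : R) := t * (expR t + expR (- t)) - (expR t - expR (- t)).
have : 0 <= f u; last by [].
apply: (@ge0_of_derive _ _ (fun t => t * (expR t - expR (- t))) u u0).
- by rewrite /f oppr0 subrr mul0r subr0.
- move=> t; rewrite /f; apply: is_derive_eq.
  by rewrite /GRing.scale /=; lra.
- move=> t /andP[t0 _]; rewrite mulr_ge0// subr_ge0 ler_expR; lra.
Qed.

Lemma expRN_lt1 (R : realType) (t : R) : 0 < t -> expR (- t) < 1.
Proof. by move=> t0; rewrite expR_lt1 oppr_lt0. Qed.

Lemma expRN_mul_le1 (R : realType) (u : R) : expR (- u) * (1 + u) <= 1.
Proof. by rewrite -[leRHS](expRxMexpNx_1 u) mulrC ler_pM2r ?expR_gt0// expR_ge1Dx. Qed.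

Lemma inv_one_sub_exp (R : realType) (u : R) : 0 < u ->
  (1 - expR (- u))^-1 <= 1 + u^-1.
Proof.
move=> u0; have q1 := expRN_lt1 u0; have h := expRN_mul_le1 u.
rewrite -[leLHS]mul1r ler_pdivrMr ?subr_gt0//.
have -> : (1 + u^-1) * (1 - expR (- u)) = (1 + u - expR (- u) * (1 + u)) / u.
  by field; rewrite gt_eqF.
by rewrite ler_pdivlMr// mul1r; lra.
Qed.

Lemma sin_le_id (R : realType) (x : R) : 0 <= x -> sin x <= x.
Proof.
move=> x0; rewrite -subr_ge0.
apply: (@ge0_of_derive _ (fun t => t - sin t) (fun t => 1 - cos t) x x0).
- by rewrite sin0 subrr.
- by move=> t _; rewrite subr_ge0 cos_le1.
Qed.

Lemma mul_cos_le_sin (R : realType) (x : R) : 0 <= x <= pi / 2 -> x * cos x <= sin x.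
Proof.
move=> /andP[x0 xpi]; rewrite -subr_ge0.
apply: (@ge0_of_derive _ (fun t => sin t - t * cos t) (fun t => t * sin t) x x0).
- by rewrite sin0 mul0r subrr.
- move=> t; have := is_deriveB (is_derive_sin t)
    (is_deriveM (is_derive_id t 1) (is_derive_cos t)).
  by move=> h; apply: (is_derive_eq h); rewrite /GRing.scale /=; ring.
- move=> t /andP[t0 tx]; rewrite mulr_ge0// sin_ge0_pi// t0 /=.
  by have := pi_gt0 R; lra.
Qed.

(** With [u = s / 2] the middle term is [1 / (4 * sinh^2 u)]; the bounds come from
    [u <= sinh u <= u * cosh u] and [cosh^2 = 1 + sinh^2]. The absence of a term
    of order [1 / s] is what later makes the mass of the kernel exact enough. *)
Lemma geo2_bounds (R : realType) (s : R) : 0 < s ->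
  (s ^+ 2)^-1 - 4^-1 <= expR (- s) / (1 - expR (- s)) ^+ 2 <= (s ^+ 2)^-1.
Proof.
move=> s0; have h0 : 0 <= s / 2 by lra.
have := sinh_ge h0; have := sinh_le h0.
have -> : expR (- s) = expR (- (s / 2)) ^+ 2 by rewrite -expRM_natl; congr expR; lra.
rewrite expRN; have := expR_gt0 (s / 2); set y := expR (s / 2) => y0 hle hge.
have ge : s <= y - y^-1 by lra.
have X0 : 0 < y - y^-1 by apply: lt_le_trans ge.
have -> : y^-1 ^+ 2 / (1 - y^-1 ^+ 2) ^+ 2 = ((y - y^-1) ^+ 2)^-1.
  have y1 : y ^+ 2 - 1 != 0.
    have -> : y ^+ 2 - 1 = y * (y - y^-1) by field; rewrite gt_eqF.
    by rewrite mulf_neq0 ?gt_eqF.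
  by field; rewrite y1 (gt_eqF y0) andbT.
have s20 : 0 < s ^+ 2 by rewrite exprn_gt0.
have X20 : 0 < (y - y^-1) ^+ 2 by rewrite exprn_gt0.
apply/andP; split; last first.
  by rewrite lef_pV2 ?posrE// ler_sqr ?nnegrE// ltW.
have hX : (y - y^-1) ^+ 2 <= s ^+ 2 * (1 + (y - y^-1) ^+ 2 / 4).
  have -> : s ^+ 2 * (1 + (y - y^-1) ^+ 2 / 4) = (s / 2 * (y + y^-1)) ^+ 2.
    by field; rewrite gt_eqF.
  by rewrite ler_sqr ?nnegrE// ?ltW// (lt_le_trans X0).
rewrite -(ler_pM2r X20) -(ler_pM2l s20) mulVf ?gt_eqF// mulr1.
apply: le_trans (_ : (y - y^-1) ^+ 2 - s ^+ 2 * (y - y^-1) ^+ 2 / 4 <= _); last by lra.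
by rewrite le_eqVlt; apply/orP; left; apply/eqP; field; rewrite gt_eqF// gt_eqF.
Qed.

(** * The Basel sum *)

(** From [x * cos x <= sin x <= x]. *)
Lemma inv_sin2_bounds (R : realType) (x : R) : 0 < x <= pi / 2 ->
  (x ^+ 2)^-1 <= (sin x ^+ 2)^-1 <= (x ^+ 2)^-1 + 1.
Proof.
move=> /andP[x0 xpi]; have sx0 : 0 < sin x.
  by rewrite sin_gt0_pi// x0 /=; have := pi_gt0 R; lra.
have sx := sin_le_id (ltW x0).
have x20 : 0 < x ^+ 2 by rewrite exprn_gt0.
have s20 : 0 < sin x ^+ 2 by rewrite exprn_gt0.
apply/andP; split; first by rewrite lef_pV2 ?posrE// ler_sqr ?nnegrE// ltW.
have xc : (x * cos x) ^+ 2 <= sin x ^+ 2.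
  have xcx : x * cos x <= sin x by rewrite mul_cos_le_sin// (ltW x0).
  have xc0 : 0 <= x * cos x.
    by rewrite mulr_ge0 ?(ltW x0)// cos_ge0_pihalf// xpi andbT; lra.
  by rewrite ler_sqr ?nnegrE// (ltW sx0).
rewrite exprMn cos2sin2 in xc.
rewrite -(ler_pM2r s20) -(ler_pM2l x20) mulVf ?gt_eqF// mulr1.
have -> : x ^+ 2 * (((x ^+ 2)^-1 + 1) * sin x ^+ 2) = sin x ^+ 2 + x ^+ 2 * sin x ^+ 2.
  by field; rewrite gt_eqF.
by move: xc; rewrite mulrBr mulr1; lra.
Qed.

Lemma sum_nat_fold (V : nmodType) (f : nat -> V) N :
  \sum_(0 <= k < N + N) f k = \sum_(0 <= k < N) (f k + f (N + N - k.+1)%N).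
Proof.
rewrite (big_cat_nat (n := N)) ?leq_addr//= big_split /=; congr (_ + _).
rewrite big_nat_rev /= -{1}(add0n N) big_addn addnK.
by apply: eq_big_nat => k /andP[_ kN]; congr f; lia.
Qed.

(** Doubling the angle: [1/sin^2 x + 1/cos^2 x = 4/sin^2 (2x)], and the angles
    at level [n.+1] come in complementary pairs. *)
Lemma sum_inv_sin2 (R : realType) n :
  \sum_(0 <= k < 2 ^ n) (sin ((2 * k + 1)%:R * pi / (4 * 2 ^+ n)) ^+ 2)^-1
  = 2 * 4 ^+ n :> R.
Proof.
elim: n => [|n IHn].
  rewrite expn0 big_nat1 muln0 add0n !expr0 !mulr1 mul1r.
  have h : cos (pi / 4 : R) = sin (pi / 4).
    by rewrite -cosBpihalf -cosN; congr cos; lra.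
  have := cos2Dsin2 (pi / 4 : R); rewrite h => e.
  have -> : sin (pi / 4 : R) ^+ 2 = 2^-1 by lra.
  by rewrite invrK.
rewrite expnS mul2n -addnn sum_nat_fold.
rewrite (eq_big_nat _ _ (F2 := fun k : nat => 4 * (sin ((2 * k + 1)%:R * pi / (4 * 2 ^+ n)) ^+ 2)^-1)).
  by rewrite -big_distrr /= IHn exprS; ring.
move=> k /andP[_ kn].
have p2 : 0 < 2 ^+ n :> R by rewrite exprn_gt0.
set y : R := (2 * k + 1)%:R * pi / (4 * 2 ^+ n.+1).
have -> : (2 * (2 ^ n + 2 ^ n - k.+1) + 1)%:R * pi / (4 * 2 ^+ n.+1) = pi / 2 - y.
  rewrite (_ : (2 * (2 ^ n + 2 ^ n - k.+1) + 1)%N = (4 * 2 ^ n - (2 * k + 1))%N); last by lia.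
  rewrite natrB ?natrM ?natrX; last by lia.
  by rewrite /y exprS; field; rewrite gt_eqF.
have -> : (2 * k + 1)%:R * pi / (4 * 2 ^+ n) = y *+ 2.
  by rewrite /y exprS -mulr_natr; field; rewrite gt_eqF.
have -> : sin (pi / 2 - y) = cos y by rewrite addrC sinDpihalf cosN.
rewrite sin_mulr2n.
have y0 : 0 < y by rewrite !mulr_gt0// ?pi_gt0// ?ltr0n ?addn1// invr_gt0 mulr_gt0// exprn_gt0.
have ypi : y < pi / 2.
  rewrite /y exprS ltr_pdivrMr ?mulr_gt0// (_ : pi / 2 * (4 * (2 * 2 ^+ n)) = (4 * 2 ^ n)%:R * pi).
    by rewrite ltr_pM2r ?pi_gt0// ltr_nat; lia.
  by rewrite natrM natrX; field.
have s0 : sin y != 0 by rewrite gt_eqF// sin_gt0_pi// y0 /=; have := pi_gt0 R; lra.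
have c0 : cos y != 0 by rewrite gt_eqF// cos_gt0_pihalf// ypi andbT; have := pi_gt0 R; lra.
transitivity ((cos y ^+ 2 + sin y ^+ 2) / (cos y * sin y) ^+ 2); first by field; rewrite s0 c0.
by rewrite cos2Dsin2; field; rewrite s0 c0.
Qed.

Definition zeta2 (R : realType) (N : nat) : R := \sum_(1 <= k < N.+1) (k%:R ^+ 2)^-1.

Definition odd_zeta2 (R : realType) (N : nat) : R :=
  \sum_(0 <= k < N) ((2 * k + 1)%:R ^+ 2)^-1.

Lemma odd_zeta2_bounds (R : realType) n :
  odd_zeta2 R (2 ^ n) <= pi ^+ 2 / 8 <= odd_zeta2 R (2 ^ n) + (2 ^ n)%:R^-1.
Proof.
have p2 : 0 < (2 ^ n)%:R :> R by rewrite ltr0n expn_gt0.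
pose a k : R := (2 * k + 1)%:R * pi / (4 * 2 ^+ n).
have aP k : (k < 2 ^ n)%N -> 0 < a k <= pi / 2.
  move=> kn; rewrite /a -natrX; apply/andP; split.
    by rewrite !mulr_gt0// ?pi_gt0// ?ltr0n ?addn1// invr_gt0 mulr_gt0.
  rewrite ler_pdivrMr ?mulr_gt0// (_ : pi / 2 * (4 * (2 ^ n)%:R) = (2 * 2 ^ n)%:R * pi).
    by rewrite ler_pM2r ?pi_gt0// ler_nat; lia.
  by rewrite natrM; field.
have aE k : (a k ^+ 2)^-1 = ((2 * k + 1)%:R ^+ 2)^-1 * (16 * (2 ^ n)%:R ^+ 2 / pi ^+ 2).
  have : (2 * k + 1)%:R != 0 :> R by rewrite pnatr_eq0 addn1.
  rewrite /a -natrX; move: ((2 * k + 1)%:R : R) (pi : R) (pi_gt0 R) => b P P0 b0.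
  by field; rewrite b0 (gt_eqF p2) (gt_eqF P0).
have SE := sum_inv_sin2 R n.
have pi2 : 0 < pi ^+ 2 :> R by rewrite exprn_gt0// pi_gt0.
have pi16 : pi ^+ 2 < 16 :> R.
  by have := pihalf_lt2 R; have := pi_gt0 R => *; nra.
have e4 : 4 ^+ n = (2 ^ n)%:R ^+ 2 :> R
  by rewrite natrX -exprM mulnC exprM expr2; congr (_ ^+ _); ring.
rewrite e4 in SE; set N : R := (2 ^ n)%:R in p2 aE SE e4 *.
have lo : odd_zeta2 R (2 ^ n) * (16 * N ^+ 2 / pi ^+ 2) <= 2 * N ^+ 2.
  rewrite -SE /odd_zeta2 big_distrl /= ler_sum_nat// => k /andP[_ kn].
  by rewrite -aE; have /andP[] := inv_sin2_bounds (aP _ kn).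
have hi : 2 * N ^+ 2 <= odd_zeta2 R (2 ^ n) * (16 * N ^+ 2 / pi ^+ 2) + N.
  rewrite -SE {2}/N -[X in _ + X](_ : \sum_(0 <= k < 2 ^ n) 1 = _); last first.
    by rewrite big_const_nat subn0 iter_addr_0.
  rewrite /odd_zeta2 big_distrl /= -big_split /= ler_sum_nat// => k /andP[_ kn].
  by rewrite -aE; have /andP[] := inv_sin2_bounds (aP _ kn).
have N20 : 0 < N ^+ 2 by rewrite exprn_gt0.
have c0 : 0 < 16 * N ^+ 2 / pi ^+ 2 by rewrite divr_gt0// mulr_gt0.
apply/andP; split; rewrite -(ler_pM2r c0).
  apply: le_trans lo _; rewrite le_eqVlt; apply/orP; left; apply/eqP;
  by move: (pi : R) (pi_gt0 R) => P P0; field; rewrite (gt_eqF P0).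
rewrite (_ : pi ^+ 2 / 8 * _ = 2 * N ^+ 2); last first.
  by move: (pi : R) (pi_gt0 R) => P P0; field; rewrite (gt_eqF P0).
apply: le_trans hi _; rewrite [leRHS]mulrDl lerD2l.
rewrite (_ : N^-1 * _ = N * (16 / pi ^+ 2)); last first.
  by move: (pi : R) (pi_gt0 R) => P P0; field; rewrite (gt_eqF P0) (gt_eqF p2).
by rewrite ler_peMr ?(ltW p2)// ler_pdivlMr// mul1r ltW.
Qed.

Lemma zeta2_double (R : realType) N : zeta2 R (2 * N) = odd_zeta2 R N + zeta2 R N / 4.
Proof.
rewrite /zeta2 /odd_zeta2; elim: N => [|N IHN]; first by rewrite muln0 !big_geq// mul0r addr0.
rewrite mulnS add2n big_nat_recr//= big_nat_recr//= IHN [in RHS]big_nat_recr//=.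
rewrite [in X in _ = _ + X]big_nat_recr//=.
have -> : (2 * N).+2%:R = 2 * N.+1%:R :> R by rewrite -natrM mulnS add2n.
have -> : (2 * N + 1)%:R = (2 * N).+1%:R :> R by rewrite addn1.
have : N.+1%:R != 0 :> R by rewrite pnatr_eq0.
have : (2 * N).+1%:R != 0 :> R by rewrite pnatr_eq0.
by move: (N.+1%:R : R) ((2 * N).+1%:R : R) => a b b0 a0; field; rewrite a0 b0.
Qed.

Lemma le_zeta2 (R : realType) M N : (M <= N)%N -> zeta2 R M <= zeta2 R N.
Proof.
move=> MN; rewrite /zeta2 [leRHS](big_cat_nat (n := M.+1))//= lerDl.
by apply: sumr_ge0 => k _; rewrite invr_ge0 exprn_ge0.
Qed.

(** Split into odd and even terms: [zeta2 (2 * N)] is the odd part plus a quarter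
    of [zeta2 N], and the odd part is at most [pi^2 / 8]. *)
Lemma zeta2_le (R : realType) N : zeta2 R N <= pi ^+ 2 / 6.
Proof.
have h1 : zeta2 R N <= zeta2 R (2 * N) by apply: le_zeta2; lia.
have h2 : odd_zeta2 R N <= odd_zeta2 R (2 ^ N).
  rewrite /odd_zeta2 [leRHS](big_cat_nat (n := N)) ?(ltnW (ltn_expl _ _))//= lerDl.
  by apply: sumr_ge0 => k _; rewrite invr_ge0 exprn_ge0.
have /andP[h3 _] := odd_zeta2_bounds R N.
by move: h1; rewrite zeta2_double; lra.
Qed.

(** The odd part is known up to [1 / N] when [N] is a power of two, and the terms
    between [N] and [2 * N] add at most [1 / N]. *)
Lemma zeta2_ge (R : realType) N : (0 < N)%N -> pi ^+ 2 / 6 - 6 / N%:R <= zeta2 R N.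
Proof.
move=> N0; have /andP[l1 l2] := trunc_log_bounds (isT : 1 < 2)%N N0.
set j := trunc_log 2 N in l1 l2.
have /andP[_ h] := odd_zeta2_bounds R j.
have := zeta2_double R (2 ^ j).
have M0 : 0 < (2 ^ j)%:R :> R by rewrite ltr0n expn_gt0.
have : zeta2 R (2 * 2 ^ j) - zeta2 R (2 ^ j) <= (2 ^ j)%:R^-1.
  have -> : zeta2 R (2 * 2 ^ j) = zeta2 R (2 ^ j) +
      \sum_((2 ^ j).+1 <= k < (2 * 2 ^ j).+1) (k%:R ^+ 2)^-1.
    by rewrite /zeta2 -big_cat_nat//=; lia.
  rewrite addrC addKr.
  apply: le_trans (_ : \sum_((2 ^ j).+1 <= k < (2 * 2 ^ j).+1) ((2 ^ j)%:R ^+ 2)^-1 <= _).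
    apply: ler_sum_nat => k /andP[k1 _]; have k0 : 0 < k%:R :> R by rewrite ltr0n; lia.
    by rewrite lef_pV2 ?posrE ?exprn_gt0// ler_sqr ?nnegrE ?ler_nat ?ler0n// ltnW.
  rewrite sumr_const_nat (_ : _ - _ = 2 ^ j)%N; last by lia.
  rewrite -[_ *+ 2 ^ j]mulr_natr expr2 invfM -mulrA mulVf ?mulr1// gt_eqF//.
have h6 : (2 ^ j)%:R^-1 <= 2 / N%:R :> R.
  rewrite ler_pdivlMr ?ltr0n// mulrC ler_pdivrMr// -natrM ler_nat.
  by move: l2; rewrite expnS; lia.
have Ninv : 0 <= N%:R^-1 :> R by rewrite invr_ge0.
have := le_zeta2 R l1; lra.
Qed.

(** * Exponential sums over the divisor function *)

Section expsums.
Context {R : realType}.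
Implicit Types (t q : R) (n m : nat).

(** The rate of decay of [p (n - i) / p n] in [i / sqrt n]; its square is the
    Basel constant. *)
Definition halfC : R := C / 2.

Definition sqrtn (n : nat) : R := Num.sqrt n%:R.

Local Notation c0 := halfC.
Local Notation rt := sqrtn.

Lemma halfC_gt0 : 0 < c0.
Proof. by rewrite divr_gt0// mulr_gt0 ?pi_gt0// sqrtr_gt0; lra. Qed.

Lemma halfC_sqr : c0 ^+ 2 = pi ^+ 2 / 6.
Proof.
rewrite /c0 /C exprMn exprMn sqr_sqrtr; last by lra.
by move: (pi : R) => P; field.
Qed.

Lemma halfC_lt2 : c0 < 2.
Proof.
have := halfC_sqr; have : pi < 4 :> R by have := pihalf_lt2 R; lra.
have := halfC_gt0; have := pi_gt0 R; move: (pi : R) c0 => P c *; nra.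
Qed.

Lemma sqrtn_sqr n : rt n ^+ 2 = n%:R.
Proof. by rewrite sqr_sqrtr. Qed.

Lemma sqrtn_ge0 n : 0 <= rt n.
Proof. exact: sqrtr_ge0. Qed.

Lemma sqrtn_ge1 n : (0 < n)%N -> 1 <= rt n.
Proof. by move=> n0; rewrite -[1]sqrtr1 ler_sqrt// ler1n. Qed.

Lemma sqrtn_gt0 n : (0 < n)%N -> 0 < rt n.
Proof. by move=> /sqrtn_ge1; apply: lt_le_trans. Qed.

Lemma le_sqrtn m n : (m <= n)%N -> rt m <= rt n.
Proof. by move=> mn; rewrite ler_wsqrtr// ler_nat. Qed.

Lemma arith_geo_sum q V : q != 1 ->
  \sum_(1 <= d < V.+1) d%:R * q ^+ d =
  q / (1 - q) ^+ 2 * (1 - V.+1%:R * q ^+ V + V%:R * q ^+ V.+1).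
Proof.
move=> q1; have q10 : 1 - q != 0 by rewrite subr_eq0 eq_sym.
elim: V => [|V IHV]; first by rewrite big_geq// expr0 mul0r addr0 mulr1 subrr mulr0.
rewrite big_nat_recr//= IHV !exprS -!natr1; move: (q ^+ V) (V%:R : R) => u v.
by field.
Qed.

Lemma expRnat t m : expR (- (t * m%:R)) = expR (- t) ^+ m.
Proof. by rewrite -mulNr expRM_natr. Qed.

Lemma sum_sigma N (f : nat -> R) :
  \sum_(1 <= m < N.+1) (sigma m)%:R * f m =
  \sum_(1 <= k < N.+1) \sum_(1 <= d < N.+1 | (k * d <= N)%N) d%:R * f (k * d)%N.
Proof.
transitivity (\sum_(1 <= m < N.+1) \sum_(1 <= d < m.+1 | (d %| m)%N) d%:R * f m).
  by apply: eq_bigr => m _; rewrite /sigma natr_sum big_distrl.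
by rewrite big_divisors (exchange_big_dep_nat xpredT).
Qed.

(** Over divisor pairs this is a double sum of [d * q^(k * d)], and the inner sum
    over [d] is at most [1 / (k * t)^2]. *)
Lemma sigma_exp_le N t : 0 < t ->
  \sum_(1 <= m < N.+1) (sigma m)%:R * expR (- (t * m%:R)) <= c0 ^+ 2 / t ^+ 2.
Proof.
move=> t0; rewrite sum_sigma; apply: le_trans (_ : zeta2 R N / t ^+ 2 <= _); last first.
  by rewrite halfC_sqr ler_pM2r ?invr_gt0 ?exprn_gt0// zeta2_le.
rewrite /zeta2 big_distrl /=; apply: ler_sum_nat => k /andP[k1 _].
have tk0 : 0 < t * k%:R by rewrite mulr_gt0// ltr0n.
have -> : (k%:R ^+ 2)^-1 / t ^+ 2 = ((t * k%:R) ^+ 2)^-1 by rewrite exprMn [RHS]invfM [RHS]mulrC.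
have /andP[_] := geo2_bounds tk0; apply: le_trans.
have q1 := expRN_lt1 tk0; have q0 := expR_ge0 (- (t * k%:R)).
set q := expR _ in q0 q1 *.
apply: le_trans (_ : \sum_(1 <= d < N.+1) d%:R * q ^+ d <= _).
  rewrite [leRHS](bigID (fun d => (k * d <= N)%N))/= -[leLHS]addr0 lerD//.
    apply: ler_sum => d _; rewrite natrM mulrA expRnat//.
  by apply: sumr_ge0 => d _; rewrite mulr_ge0// exprn_ge0.
rewrite arith_geo_sum ?lt_eqF//.
rewrite ler_piMr ?divr_ge0 ?exprn_ge0 ?subr_ge0 ?(ltW q1)//.
rewrite exprS -natr1.
have : q ^+ N <= 1 by rewrite exprn_ile1// ltW.
have : 0 <= q ^+ N by rewrite exprn_ge0.
have : 0 <= N%:R :> R by [].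
move: (q ^+ N) (N%:R : R) => u v v0 u0 u1.
have : 0 <= v * u * (1 - q) by rewrite !mulr_ge0// subr_ge0 ltW.
lra.
Qed.

Lemma pow_le_exp (u : R) j : 0 <= u -> u ^+ j <= j`!%:R * expR u.
Proof.
move=> u0; case: j => [|j]; first by rewrite expr0 fact0 mul1r -[leLHS]expR0 ler_expR.
have h := expR_ge1Dxn j u0; have f0 : 0 < j.+1`!%:R :> R by rewrite ltr0n fact_gt0.
by rewrite -[leLHS](divfK (lt0r_neq0 f0)) [leRHS]mulrC ler_pM2r//; lra.
Qed.

Lemma pow_exp_le (a u : R) j : 0 < a -> 0 <= u ->
  u ^+ j * expR (- (u / a)) <= j`!%:R * a ^+ j.
Proof.
move=> a0 u0; have := @pow_le_exp (u / a) j (divr_ge0 u0 (ltW a0)).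
rewrite expRN ler_pdivrMr ?expR_gt0// exprMn exprVn ler_pdivrMr ?exprn_gt0//.
by rewrite -!mulrA [expR _ * _]mulrC.
Qed.

Lemma nat_sqrtn n : (0 < n)%N -> exists2 K, (0 < K)%N & K%:R <= rt n < K.+1%:R.
Proof.
move=> n0; exists (Num.truncn (rt n)); last exact/truncn_itv/sqrtn_ge0.
by rewrite truncn_gt0 sqrtn_ge1.
Qed.

(** Only the [k <= sqrt n] are kept. For these, cutting the inner geometric sum
    at [n / k] costs an exponentially small amount, the tail of the Basel sum is
    [O (1 / sqrt n)], and the defect in [geo2_bounds] is bounded for each [k]. *)
Lemma sigma_exp_ge : exists2 D : R, 0 < D & forall n, (0 < n)%N ->
  n%:R - D * rt n <=
  \sum_(1 <= m < n.+1) (sigma m)%:R * expR (- (c0 / rt n * m%:R)).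
Proof.
pose D1 : R := 96 / c0 ^+ 3; pose D2 : R := 12 / c0 ^+ 2 + 1.
have c00 := halfC_gt0.
have D10 : 0 < D1 by rewrite divr_gt0 ?exprn_gt0.
have D20 : 0 < D2 by rewrite addr_gt0 ?divr_gt0 ?exprn_gt0.
exists (D1 + D2 + 2) => [|n n0]; first by lra.
set s := rt n; have s1 : 1 <= s := sqrtn_ge1 n0.
have s0 : 0 < s by lra.
have sn : s ^+ 2 = n%:R := sqrtn_sqr n.
set t := c0 / s; have t0 : 0 < t by rewrite divr_gt0.
set S := (X in _ <= X).
have S0 : 0 <= S by apply: sumr_ge0 => m _; rewrite mulr_ge0// expR_ge0.
have [sD|sD] := leP s (D1 + 2).
  by apply: le_trans S0; rewrite -sn expr2 -mulrBl pmulr_lle0//; lra.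
have := nat_sqrtn n0; rewrite -/s => -[K K0 /andP[Ks sK]].
have Kn : (K <= n)%N.
  rewrite -(ler_nat R) -sn; apply: le_trans Ks _.
  by rewrite expr2 ler_peMr// ltW.
have K0r : 0 < K%:R :> R by rewrite ltr0n.
have sK2 : s <= 2 * K%:R.
  have : 1 <= K%:R :> R by rewrite ler1n.
  by rewrite -natr1 in sK; lra.
have main : (1 - D1 / s) * \sum_(1 <= k < K.+1) (((t * k%:R) ^+ 2)^-1 - 4^-1) <= S.
  rewrite /S sum_sigma [leRHS](big_cat_nat (n := K.+1))//= -[leLHS]addr0 lerD//; last first.
    by apply: sumr_ge0 => k _; apply: sumr_ge0 => d _; rewrite mulr_ge0// expR_ge0.
  rewrite big_distrr /=; apply: ler_sum_nat => k /andP[k1 kK].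
  have k0r : 0 < k%:R :> R by rewrite ltr0n.
  have ks : k%:R <= s by apply: le_trans Ks; rewrite ler_nat.
  have tk0 : 0 < t * k%:R by rewrite mulr_gt0.
  have /andP[ge _] := geo2_bounds tk0.
  have q1 := expRN_lt1 tk0; have q0 := expR_gt0 (- (t * k%:R)).
  have qE d : expR (- (t * (k * d)%:R)) = expR (- (t * k%:R)) ^+ d.
    by rewrite natrM mulrA expRnat.
  pose V := (n %/ k)%N.
  have qV : V.+1%:R * expR (- (t * k%:R)) ^+ V <= D1 / s.
    rewrite -qE; have Vn : V.+1%:R <= 2 * s ^+ 2.
      by rewrite sn -natrM ler_nat mul2n -addnn -addn1 leq_add// leq_div.
    have kV : s ^+ 2 / 2 <= (k * V)%:R.
      have : (n < k * V + k)%N by rewrite mulnC -mulSnr ltn_ceil// ltnW.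
      rewrite -(ltr_nat R) natrD -sn => h; nra.
    apply: le_trans (_ : 2 * s ^+ 2 * expR (- (s / (2 / c0))) <= _).
      apply: ler_pM => //.
      rewrite ler_expR lerN2 /t; apply: le_trans (_ : c0 / s * (s ^+ 2 / 2) <= _).
        by rewrite le_eqVlt; apply/orP; left; apply/eqP; field; rewrite !gt_eqF.
      by rewrite ler_pM2l.
    rewrite ler_pdivlMr// (_ : _ * s = 2 * (s ^+ 3 * expR (- (s / (2 / c0))))); last by ring.
    have := @pow_exp_le (2 / c0) s 3 (divr_gt0 (ltr0Sn _ _) c00) (ltW s0).
    rewrite (_ : 3`! = 6)%N// /D1 => h.
    have -> : 96 / c0 ^+ 3 = 2 * (6%:R * (2 / c0) ^+ 3) by field; rewrite gt_eqF.
    by rewrite ler_pM2l.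
  set q := expR (- (t * k%:R)) in q0 q1 qV ge *.
  rewrite (_ : \sum_(_ <= d < _ | _) _ = \sum_(1 <= d < V.+1) d%:R * q ^+ d); last first.
    rewrite [RHS](big_nat_widen _ _ n.+1)/=; last by rewrite ltnS leq_div.
    rewrite big_nat_cond [RHS]big_nat_cond; apply: eq_big => d.
      by rewrite !ltnS /V leq_divRL// mulnC.
    by move=> _; rewrite qE.
  rewrite arith_geo_sum ?lt_eqF//.
  have X0 : 0 < q / (1 - q) ^+ 2 by rewrite divr_gt0 ?exprn_gt0 ?subr_gt0.
  apply: le_trans (_ : (1 - D1 / s) * (q / (1 - q) ^+ 2) <= _).
    by rewrite ler_wpM2l// subr_ge0 ler_pdivrMr// mul1r; lra.
  rewrite mulrC ler_pM2l//.
  have : 0 <= V%:R * q ^+ V.+1 by rewrite mulr_ge0// exprn_ge0// ltW.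
  lra.
apply: le_trans main.
have sumE : n%:R - D2 * s <= \sum_(1 <= k < K.+1) (((t * k%:R) ^+ 2)^-1 - 4^-1).
  rewrite sumrB sumr_const_nat subSS subn0 (_ : \sum_(_ <= _ < _) _ = zeta2 R K / t ^+ 2).
    have := zeta2_ge R K0; rewrite -halfC_sqr => h.
    have tE : (t ^+ 2)^-1 = s ^+ 2 / c0 ^+ 2 by rewrite /t; field; rewrite !gt_eqF.
    have : (c0 ^+ 2 - 6 / K%:R) * (t ^+ 2)^-1 <= zeta2 R K / t ^+ 2.
      by rewrite ler_pM2r// invr_gt0 exprn_gt0.
    have -> : (c0 ^+ 2 - 6 / K%:R) * (t ^+ 2)^-1 = n%:R - 6 / c0 ^+ 2 * (s * s / K%:R).
      by rewrite tE -sn; field; rewrite !gt_eqF.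
    have : s * s / K%:R <= 2 * s.
      by rewrite ler_pdivrMr// mulrAC ler_pM2r.
    have : 4^-1 *+ K <= s.
      rewrite -[4^-1 *+ K]mulr_natr; lra.
    have : 0 < 6 / c0 ^+ 2 by rewrite divr_gt0// exprn_gt0.
    rewrite /D2 (_ : 12 / c0 ^+ 2 = 2 * (6 / c0 ^+ 2)); last by lra.
    move: (6 / c0 ^+ 2) (s * s / K%:R) => a b a0 h1 h2 h3; nra.
  rewrite /zeta2 big_distrl /=; apply: eq_bigr => k _.
  by rewrite exprMn [LHS]invfM [LHS]mulrC.
apply: le_trans (ler_wpM2l _ sumE); last by rewrite subr_ge0 ler_pdivrMr// mul1r; lra.
have -> : (1 - D1 / s) * (n%:R - D2 * s) = n%:R - D2 * s - D1 * s + D1 * D2.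
  by rewrite -sn; field; rewrite gt_eqF.
have := mulr_gt0 D10 D20; nra.
Qed.

End expsums.

(** * A priori bounds on the growth of [p] *)

Section growth.
Context {R : realType}.
Local Notation rt := (@sqrtn R).
Local Notation c0 := (@halfC R).

Definition partR (n : nat) : R := (p n)%:R.

Local Notation P := partR.

(** The value at [0] continues [p] by zero to the left, which is the convention
    under which [pincr_recursion] contains all its boundary terms. *)
Definition pincr (n : nat) : R := if n is n'.+1 then P n - P n' else 1.

Local Notation d := pincr.

Definition rincr (n : nat) : R := d n / P n.

Local Notation r := rincr.

Lemma partR_gt0 n : 0 < P n.
Proof. by rewrite ltr0n p_gt0. Qed.

Lemma le_partR m n : (m <= n)%N -> P m <= P n.
Proof. by move=> mn; rewrite ler_nat leq_p. Qed.

Lemma partR_recursion n :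
  n%:R * P n = \sum_(1 <= m < n.+1) (sigma m)%:R * P (n - m).
Proof.
rewrite /P -natrM p_recursion natr_sum.
by apply: eq_bigr => m _; rewrite natrM.
Qed.

Lemma pincr_ge0 n : 0 <= d n.
Proof. by case: n => [|n]//=; rewrite subr_ge0 le_partR. Qed.

Lemma pincr_le_succ n : (0 < n)%N -> d n <= d n.+1.
Proof.
case: n => //= n _; have := p_convex n; rewrite /P -(ler_nat R) !natrD.
lra.
Qed.

Lemma le_pincr m n : (0 < m <= n)%N -> d m <= d n.
Proof.
move=> /andP[m0 mn]; rewrite -(subnKC mn); elim: (n - m)%N => [|j IHj]; rewrite ?addn0//.
by rewrite addnS (le_trans IHj)// pincr_le_succ// addn_gt0 m0.
Qed.

Lemma partR_add_ge n j : (0 < n)%N -> P n + j%:R * d n <= P (n + j).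
Proof.
move=> n0; elim: j => [|j IHj]; first by rewrite mul0r addr0 addn0.
have : d n <= d (n + j).+1 by apply: le_pincr; rewrite n0; lia.
rewrite addnS -natr1 /= => h; rewrite mulrDl mul1r; lra.
Qed.

Lemma rincr_ge0 n : 0 <= r n.
Proof. by rewrite divr_ge0// ?pincr_ge0// ltW// partR_gt0. Qed.

Lemma pincr_le_partR n : d n <= P n.
Proof.
case: n => [|n]/=; first by rewrite /P p0.
by rewrite gerBl ltW// partR_gt0.
Qed.

Lemma rincr_le1 n : r n <= 1.
Proof. by rewrite ler_pdivrMr ?partR_gt0// mul1r pincr_le_partR. Qed.

Lemma partR_predE n : (0 < n)%N -> P n.-1 = P n * (1 - r n).
Proof.
case: n => //= n _; rewrite mulrBr mulr1 /r mulrCA divff ?gt_eqF ?partR_gt0//=; lra.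
Qed.

Lemma sigma_ge m : (0 < m)%N -> m%:R <= (sigma m)%:R :> R.
Proof.
move=> m0; rewrite ler_nat /sigma big_mkcond /= big_nat_recr//= dvdnn.
exact: leq_addl.
Qed.

Lemma sum_id_ge M : M%:R ^+ 2 / 2 <= \sum_(1 <= m < M.+1) m%:R :> R.
Proof.
elim: M => [|M IHM]; first by rewrite big_geq// expr0n mul0r.
rewrite big_nat_recr//= -natr1; have : 0 <= M%:R :> R by []; lra.
Qed.

(** The terms [m <= M] of the recursion are at least [m * P (i - M)] each. *)
Lemma partR_sub_le i M : (0 < M <= i)%N -> P (i - M) * M%:R ^+ 2 <= 2 * i%:R * P i.
Proof.
move=> /andP[M0 Mi]; rewrite -mulrA partR_recursion.
rewrite (big_cat_nat (n := M.+1))//= mulrDr.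
have h : 0 <= \sum_(M.+1 <= m < i.+1) (sigma m)%:R * P (i - m).
  by apply: sumr_ge0 => m _; rewrite mulr_ge0// ltW// partR_gt0.
apply: le_trans (_ : 2 * \sum_(1 <= m < M.+1) (sigma m)%:R * P (i - m) <= _); last by lra.
apply: le_trans (_ : 2 * (P (i - M) * \sum_(1 <= m < M.+1) m%:R) <= _).
  have := sum_id_ge M; have := partR_gt0 (i - M).
  move: (P _) (\sum_(_ <= _ < _) _) => a b a0 h1; nra.
rewrite ler_pM2l// big_distrr /=; apply: ler_sum_nat => m /andP[m1 mM].
by rewrite mulrC; apply: ler_pM; rewrite ?ler0n ?sigma_ge ?le_partR//; lia.
Qed.

(** Going down by [2 * sqrt n] halves [P] at least, by [partR_sub_le]. *)
Lemma partR_sub_exp n m : (0 < n)%N -> (m <= n)%N ->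
  P (n - m) <= 2 * expR (- (m%:R / (6 * rt n))) * P n.
Proof.
move=> n0 mn; set s := rt n; have s1 : 1 <= s := sqrtn_ge1 n0.
have s0 : 0 < s by lra.
have sn : s ^+ 2 = n%:R := sqrtn_sqr n.
(* Some [M] in [2 * s < M <= 3 * s], uniformly good at all [i <= n]. *)
pose M := (Num.truncn (2 * s)).+1.
have s20 : 0 <= 2 * s by lra.
have /andP[M1' M2] := truncn_itv s20; rewrite -/M in M2.
have M1 : M%:R - 1 <= 2 * s by rewrite /M -natr1 addrK.
have half j : (j * M <= n)%N -> 2 ^+ j * P (n - j * M) <= P n.
  elim: j => [|j IHj] jn; first by rewrite mul0n subn0 mul1r.
  have jn' : (j * M <= n)%N by move: jn; rewrite mulSn; lia.
  apply: le_trans (IHj jn'); rewrite exprSr -mulrA ler_pM2l ?exprn_gt0//.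
  have h : (0 < M <= n - j * M)%N by move: jn; rewrite mulSn; lia.
  have := partR_sub_le h; rewrite -subnDA -mulSnr => h1.
  have h2 : (n - j * M)%:R <= s ^+ 2 by rewrite sn ler_nat leq_subr.
  have : 0 < P (n - j * M) by exact: partR_gt0.
  have : 0 < P (n - j.+1 * M) by exact: partR_gt0.
  move: (P (n - j * M)) (P (n - j.+1 * M)) ((n - j * M)%:R : R) h1 h2 => a b c.
  move=> h1 h2 b0 a0.
  have M4 : 4 * s ^+ 2 <= M%:R ^+ 2 by nra.
  have : b * (4 * s ^+ 2) <= b * M%:R ^+ 2 by rewrite ler_pM2l.
  have : c * a <= s ^+ 2 * a by rewrite ler_pM2r.
  have ss0 : 0 < 2 * s ^+ 2 by rewrite mulr_gt0// exprn_gt0.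
  move=> u1 u2; rewrite -(ler_pM2l ss0). nra.
pose j := (m %/ M)%N.
have jm : (j * M <= m)%N by rewrite leq_trunc_div.
have := half j (leq_trans jm mn).
have Pj : P (n - m) <= P (n - j * M) by apply: le_partR; lia.
have e2 : expR (- 2^-1) >= 2^-1 :> R by have := expR_ge1Dx (- 2^-1 : R); lra.
have ej : 2^-1 ^+ j.+1 <= expR (- (m%:R / (6 * s))).
  apply: le_trans (_ : expR (- 2^-1) ^+ j.+1 <= _).
    by rewrite lerXn2r ?nnegrE ?expR_ge0.
  rewrite -expRM_natl ler_expR mulrN lerN2 ler_pdivrMr ?mulr_gt0//.
  have : (m < j.+1 * M)%N by rewrite ltn_ceil.
  rewrite -(ltr_nat R) natrM => h.
  have : 0 < j.+1%:R :> R by [].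
  by move: (j.+1%:R : R) (M%:R : R) M1 M2 h => u v h1 h2 h u0; nra.
move=> h; have h2 : 0 < 2 ^+ j :> R by rewrite exprn_gt0.
apply: le_trans Pj _; rewrite -(ler_pM2l h2); apply: le_trans h _.
rewrite exprSr exprVn in ej.
have : 2^-1 <= 2 ^+ j * expR (- (m%:R / (6 * s))) by rewrite -ler_pdivrMl// mulrC.
have := partR_gt0 n; move: (expR _) (P n) (2 ^+ j : R) => u v w v0 h3; nra.
Qed.

Lemma expR1_le4 : expR 1 <= 4 :> R.
Proof.
have e2 : expR (- 2^-1) >= 2^-1 :> R by have := expR_ge1Dx (- 2^-1 : R); lra.
have -> : expR 1 = expR 2^-1 ^+ 2 :> R by rewrite -expRM_natl; congr expR; lra.
have : expR 2^-1 <= 2 :> R.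
  by rewrite -[2^-1]opprK expRN -[leRHS]invrK lef_pV2 ?posrE ?expR_gt0.
have := expR_gt0 (2^-1 : R); move: (expR _) => u *; nra.
Qed.

(** In the recursion at [n + j] the terms [m <= j] have total at most a quarter of
    the left-hand side, and the other terms are controlled by the exponential
    decay of [P] below [n]. *)
Lemma partR_add_le n j : (0 < n)%N -> j%:R <= rt n / 8 :> R -> P (n + j) <= 800 * P n.
Proof.
move=> n0; set s : R := rt n => js; have s1 : 1 <= s := sqrtn_ge1 n0.
have s0 : 0 < s by lra.
have sn : s ^+ 2 = n%:R := sqrtn_sqr n.
have e4 := expR1_le4; have c2 : c0 ^+ 2 < 4 :> R by have := @halfC_lt2 R; have := @halfC_gt0 R => *; nra.
have Pn0 := partR_gt0 n; have PN0 := partR_gt0 (n + j).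
have rec := partR_recursion (n + j); rewrite (big_cat_nat (n := j.+1)) in rec => //; last by lia.
have h1 : \sum_(1 <= m < j.+1) (sigma m)%:R * P (n + j - m) <= n%:R / 4 * P (n + j).
  (* As [j <= s / 8], damping at rate [8 / s] loses at most a factor [e]. *)
  apply: le_trans (_ : (\sum_(1 <= m < j.+1) (sigma m)%:R * (expR 1 * expR (- (8 / s * m%:R)))) * P (n + j) <= _).
    rewrite big_distrl /=; apply: ler_sum_nat => m /andP[m1 mj].
    rewrite -mulrA ler_wpM2l// -[leLHS]mul1r.
    apply: ler_pM; rewrite ?ler01 ?(ltW (partR_gt0 _)) ?le_partR ?leq_subr//.
    rewrite -expRD -[leLHS]expR0 ler_expR subr_ge0 mulrAC ler_pdivrMr// mul1r.
    have : m%:R <= j%:R :> R by rewrite ler_nat.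
    lra.
  rewrite ler_pM2r//; under eq_bigr do rewrite mulrCA; rewrite -big_distrr /=.
  have t0 : 0 < 8 / s by rewrite divr_gt0.
  have := sigma_exp_le j t0.
  have -> : c0 ^+ 2 / (8 / s) ^+ 2 = c0 ^+ 2 / 64 * s ^+ 2 :> R by field; rewrite gt_eqF.
  rewrite sn; move: (\sum_(_ <= _ < _) _) => u hu.
  apply: le_trans (ler_wpM2l (expR_ge0 1) hu) _; rewrite mulrA mulrC ler_pM2l ?ltr0n//.
  have := expR_gt0 (1 : R); move: (expR 1) (c0 ^+ 2 : R) e4 c2 => a b e4 c2 a0; nra.
have h2 : \sum_(j.+1 <= m < (n + j).+1) (sigma m)%:R * P (n + j - m) <= 576 * n%:R * P n.
  apply: le_trans (_ : (\sum_(j.+1 <= m < (n + j).+1) (sigma m)%:R * (4 * expR (- ((6 * s)^-1 * m%:R)))) * P n <= _).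
    rewrite big_distrl /=; apply: ler_sum_nat => m /andP[m1 mj].
    rewrite -mulrA ler_wpM2l//; have -> : (n + j - m = n - (m - j))%N by lia.
    have mjn : (m - j <= n)%N by lia.
    apply: le_trans (partR_sub_exp n0 mjn) _; rewrite ler_pM2r// -/s.
    have -> : expR (- ((m - j)%:R / (6 * s))) = expR (- ((6 * s)^-1 * m%:R)) * expR (j%:R / (6 * s)).
      by rewrite -expRD natrB; [congr expR; field; rewrite gt_eqF|lia].
    have : expR (j%:R / (6 * s)) <= 2.
      apply: le_trans (_ : expR 2^-1 <= _); first by rewrite ler_expR ler_pdivrMr ?mulr_gt0//; lra.
      have := expR_gt0 (2^-1 : R); have : expR 2^-1 ^+ 2 = expR 1 :> R by rewrite -expRM_natl; congr expR; lra.
      move: (expR 2^-1) (expR 1) e4 => u v *; nra.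
    have := expR_gt0 (- ((6 * s)^-1 * m%:R)); move: (expR _) (expR _) => u v u0 v2; nra.
  rewrite ler_pM2r//; apply: le_trans (_ : \sum_(1 <= m < (n + j).+1) (sigma m)%:R * (4 * expR (- ((6 * s)^-1 * m%:R))) <= _).
    rewrite [leRHS](big_cat_nat (n := j.+1))//=; last by lia.
    by rewrite lerDr sumr_ge0// => m _; rewrite !mulr_ge0// expR_ge0.
  under eq_bigr do rewrite mulrCA; rewrite -big_distrr /=.
  have t0 : 0 < (6 * s)^-1 by rewrite invr_gt0 mulr_gt0.
  apply: le_trans (ler_wpM2l _ (sigma_exp_le (n + j) t0)) _; first by lra.
  have -> : c0 ^+ 2 / (6 * s)^-1 ^+ 2 = 36 * c0 ^+ 2 * s ^+ 2 :> R by field; rewrite gt_eqF.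
  rewrite sn; have : 0 < n%:R :> R by rewrite ltr0n.
  move: (n%:R : R) (c0 ^+ 2 : R) c2 => a b *; nra.
rewrite natrD in rec; have nr0 : 0 < n%:R :> R by rewrite ltr0n.
have j0 : 0 <= j%:R * P (n + j) by rewrite mulr_ge0// ltW.
rewrite -(ler_pM2l nr0).
rewrite mulrDl /= in rec.
have : n%:R * P (n + j) <= n%:R / 4 * P (n + j) + 576 * n%:R * P n by lra.
have : 0 < n%:R * P n by rewrite mulr_gt0.
move: (n%:R * P n) (n%:R * P (n + j)) => *; nra.
Qed.

(** By convexity the increment at [n] is at most the mean slope over the next
    [sqrt n / 8] steps, over which [P] grows by a bounded factor only. *)
Lemma rincr_le n : (0 < n)%N -> r n <= 12800 / rt n.
Proof.
move=> n0; set s := rt n; have s1 : 1 <= s := sqrtn_ge1 n0.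
have s0 : 0 < s by lra.
have [s8|s8] := leP 8 s; last first.
  by apply: le_trans (rincr_le1 n) _; rewrite ler_pdivlMr//; lra.
pose j := Num.truncn (s / 8).
have /andP[j1 j2] : j%:R <= s / 8 < j.+1%:R by apply: truncn_itv; lra.
have h := partR_add_le n0 j1; have := partR_add_ge j n0.
have Pn0 := partR_gt0 n.
rewrite ler_pdivrMr// mulrAC ler_pdivlMr// => h1.
have j16 : s <= 16 * j%:R.
  have : 1 <= j%:R :> R.
    by rewrite ler1n truncn_gt0; lra.
  have jS : j.+1%:R = j%:R + 1 :> R by rewrite natr1.
  by rewrite jS in j2; lra.
have := pincr_ge0 n; move: (d n) (P n) (P (n + j)) (j%:R : R) h h1 j16 Pn0 => a b c e *; nra.
Qed.

End growth.

(** * Linear relations between the relative increments *)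

Section relations.
Context {R : realType}.
Local Notation P := (@partR R).
Local Notation d := (@pincr R).
Local Notation r := (@rincr R).
Local Notation rt := (@sqrtn R).
Local Notation c0 := (@halfC R).

Definition rincr_err (n : nat) : R := r n - c0 / rt n.

Local Notation E := rincr_err.

Definition pratio (n m : nat) : R := P (n - m) / P n.

Local Notation x := pratio.

Definition pgeo (n : nat) : R := expR (- (c0 / rt n)).

Lemma pratio_ge0 n m : 0 <= x n m.
Proof. by rewrite divr_ge0// ltW// partR_gt0. Qed.

Lemma pratio_le1 n m : x n m <= 1.
Proof. by rewrite ler_pdivrMr ?partR_gt0// mul1r le_partR// leq_subr. Qed.

Lemma pratio0 n : x n 0 = 1.
Proof. by rewrite /x subn0 divff// gt_eqF// partR_gt0. Qed.

Lemma pratio_le_exp n m : (0 < n)%N -> (m <= n)%N ->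
  x n m <= 2 * expR (- (m%:R / (6 * rt n))).
Proof. by move=> n0 mn; rewrite ler_pdivrMr ?partR_gt0// partR_sub_exp. Qed.

Lemma pratioS n m : (m < n)%N -> x n m.+1 = x n m * (1 - r (n - m)).
Proof.
by move=> mn; rewrite /x mulrAC -partR_predE ?subn_gt0// subnS.
Qed.

Lemma rincr_err_le3 n : `|E n| <= 3.
Proof.
rewrite /E; case: n => [|n].
  rewrite /rt sqrtr0 invr0 mulr0 subr0 ger0_norm ?rincr_ge0//.
  by have := @rincr_le1 R 0; lra.
have s1 : 1 <= rt n.+1 by exact: sqrtn_ge1.
have s0 : 0 < rt n.+1 by lra.
have : 0 <= c0 / rt n.+1 by rewrite divr_ge0 ?ltW ?halfC_gt0.
have : c0 / rt n.+1 <= c0 by rewrite ler_pdivrMr// ler_peMr// (ltW (@halfC_gt0 R)).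
have := @rincr_le1 R n.+1; have := @rincr_ge0 R n.+1; have := @halfC_lt2 R.
by rewrite ler_norml; lra.
Qed.

Lemma rincr_err_le_sqrtn n : (0 < n)%N -> `|E n| <= 12802 / rt n.
Proof.
move=> n0; have s0 : 0 < rt n by exact: sqrtn_gt0.
have h := @rincr_le R n n0; have h0 := @rincr_ge0 R n.
have : 0 <= c0 / rt n by rewrite divr_ge0 ?ltW ?halfC_gt0.
have : c0 / rt n <= 2 / rt n by rewrite ler_pM2r ?invr_gt0// ltW// halfC_lt2.
by rewrite /E ler_norml; lra.
Qed.

Lemma geo_sum_le (u : R) N : 0 < u ->
  \sum_(0 <= j < N) expR (- (u * j%:R)) <= 1 + u^-1.
Proof.
move=> u0; have q1 := expRN_lt1 u0; have q0 := expR_gt0 (- u).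
have qi := inv_one_sub_exp u0.
apply: le_trans qi; rewrite -[leRHS]mul1r ler_pdivlMr ?subr_gt0//.
set q := expR (- u) in q0 q1 *.
suff -> : (\sum_(0 <= j < N) expR (- (u * j%:R))) * (1 - q) = 1 - q ^+ N.
  by rewrite gerBl exprn_ge0// ltW.
elim: N => [|N IHN]; first by rewrite big_geq// mul0r expr0 subrr.
by rewrite big_nat_recr//= mulrDl IHN expRnat -/q exprS; ring.
Qed.

Lemma pratio_pow_le b n m : (0 < n)%N -> (m <= n)%N ->
  x n m * m%:R ^+ b <=
  2 * (b`!%:R * (12 * rt n) ^+ b) * expR (- ((12 * rt n)^-1 * m%:R)).
Proof.
move=> n0 mn; have s0 : 0 < rt n by exact: sqrtn_gt0.
apply: le_trans (ler_wpM2r _ (pratio_le_exp n0 mn)) _; first by rewrite exprn_ge0.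
have -> : expR (- (m%:R / (6 * rt n))) =
    expR (- (m%:R / (12 * rt n))) * expR (- ((12 * rt n)^-1 * m%:R)).
  by rewrite -expRD; congr expR; field; rewrite gt_eqF.
have a0 : 0 < 12 * rt n by rewrite mulr_gt0.
have := @pow_exp_le R (12 * rt n) m%:R b a0 (ler0n _ _).
have := expR_gt0 (- ((12 * rt n)^-1 * m%:R)).
move: (expR _) (expR _) (m%:R ^+ b) (_ * _ ^+ b) => u v w y v0 h.
have : v * (w * u) <= v * y by rewrite ler_pM2l.
lra.
Qed.

Lemma sigma_moment b : exists2 D : R, 0 < D & forall n, (0 < n)%N ->
  \sum_(1 <= m < n.+1) (sigma m)%:R * (x n m * m%:R ^+ b) <= D * rt n ^+ b.+2.
Proof.
pose D : R := 2 * (b`!%:R * 12 ^+ b) * (144 * c0 ^+ 2).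
have c00 := @halfC_gt0 R.
have b0 : 0 < b`!%:R * 12 ^+ b :> R by rewrite mulr_gt0 ?exprn_gt0// ltr0n fact_gt0.
exists D => [|n n0]; first by rewrite /D mulr_gt0// mulr_gt0// exprn_gt0.
have s0 : 0 < rt n by exact: sqrtn_gt0.
apply: le_trans (_ : 2 * (b`!%:R * (12 * rt n) ^+ b) *
   \sum_(1 <= m < n.+1) (sigma m)%:R * expR (- ((12 * rt n)^-1 * m%:R)) <= _).
  rewrite big_distrr /=; apply: ler_sum_nat => m /andP[m1 mn].
  by rewrite [leRHS]mulrCA ler_wpM2l//; exact: pratio_pow_le.
have t0 : 0 < (12 * rt n)^-1 by rewrite invr_gt0 mulr_gt0.
apply: le_trans (ler_wpM2l _ (sigma_exp_le n t0)) _.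
  by rewrite mulr_ge0// mulr_ge0// exprn_ge0// mulr_ge0// ltW.
rewrite /D !exprS exprMn; move: (rt n ^+ b) (12 ^+ b : R) (b`!%:R : R) => u v w.
rewrite le_eqVlt; apply/orP; left; apply/eqP; field.
by rewrite gt_eqF.
Qed.

Lemma pratio_moment b : exists2 D : R, 0 < D & forall n, (0 < n)%N ->
  \sum_(0 <= m < n.+1) x n m * m%:R ^+ b <= D * rt n ^+ b.+1.
Proof.
pose D : R := 2 * (b`!%:R * 12 ^+ b) * 13.
have b0 : 0 < b`!%:R * 12 ^+ b :> R by rewrite mulr_gt0 ?exprn_gt0// ltr0n fact_gt0.
exists D => [|n n0]; first by rewrite /D mulr_gt0// mulr_gt0.
have s1 : 1 <= rt n by exact: sqrtn_ge1.
have s0 : 0 < rt n by exact: sqrtn_gt0.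
apply: le_trans (_ : 2 * (b`!%:R * (12 * rt n) ^+ b) *
   \sum_(0 <= m < n.+1) expR (- ((12 * rt n)^-1 * m%:R)) <= _).
  rewrite big_distrr /=; apply: ler_sum_nat => m /andP[_ mn].
  exact: pratio_pow_le.
have t0 : 0 < (12 * rt n)^-1 by rewrite invr_gt0 mulr_gt0.
have h := geo_sum_le n.+1 t0; rewrite invrK in h.
have A0 : 0 <= 2 * (b`!%:R * (12 * rt n) ^+ b).
  by rewrite mulr_ge0// mulr_ge0// exprn_ge0// mulr_ge0// ltW.
apply: le_trans (ler_wpM2l A0 h) _.
apply: le_trans (_ : 2 * (b`!%:R * (12 * rt n) ^+ b) * (13 * rt n) <= _).
  by rewrite ler_wpM2l//; lra.
rewrite /D exprS exprMn; move: (rt n ^+ b) (12 ^+ b : R) (b`!%:R : R) => u v w.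
by rewrite le_eqVlt; apply/orP; left; apply/eqP; ring.
Qed.

Lemma sum_kernel n : (0 < n)%N ->
  \sum_(1 <= m < n.+1) (sigma m)%:R * x n m = n%:R.
Proof.
move=> n0; rewrite /x; under eq_bigr do rewrite mulrA.
by rewrite -big_distrl /= -partR_recursion mulfK// gt_eqF// partR_gt0.
Qed.

Lemma sqrtn_inv_diff_half n m : (0 < n)%N -> (2 * m <= n)%N ->
  `|(rt (n - m))^-1 - (rt n)^-1| <= 2 * m%:R / rt n ^+ 3.
Proof.
move=> n0 mn2; set s := rt n; have s1 : 1 <= s by exact: sqrtn_ge1.
have s0 : 0 < s by lra.
have sn : s ^+ 2 = n%:R by exact: sqrtn_sqr.
have m0 : 0 <= m%:R :> R by [].
have mn : (m <= n)%N by lia.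
have nm : (0 < n - m)%N by lia.
have m2 : 2 * m%:R <= s ^+ 2 by rewrite sn -natrM ler_nat.
set a := rt (n - m); have a0 : 0 < a by exact: sqrtn_gt0.
have a2 : a ^+ 2 = s ^+ 2 - m%:R by rewrite sqrtn_sqr natrB// sn.
have as_ : a <= s by apply: le_sqrtn; rewrite leq_subr.
have sa : s <= 2 * a by nra.
have -> : a^-1 - s^-1 = m%:R / (a * s * (s + a)).
  have -> : m%:R = s ^+ 2 - a ^+ 2 by lra.
  by field; rewrite !gt_eqF// addr_gt0.
have D0 : 0 < a * s * (s + a) by rewrite !mulr_gt0// addr_gt0.
rewrite ger0_norm ?divr_ge0// ?(ltW D0)//.
rewrite ler_pdivrMr//.
have -> : 2 * m%:R / s ^+ 3 * (a * s * (s + a)) = m%:R * (2 * (a * s * (s + a)) / s ^+ 3).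
  by field; rewrite gt_eqF.
rewrite ler_peMr// ler_pdivlMr ?exprn_gt0// mul1r exprS.
have : s ^+ 2 <= 2 * a * (s + a) by nra.
by move: (s ^+ 2) => u hu; nra.
Qed.

(** The second term takes over for [m > n / 2], where the difference is just
    bounded. *)
Lemma sqrtn_inv_diff n m : (0 < n)%N -> (m <= n)%N ->
  `|(rt (n - m))^-1 - (rt n)^-1| <= 2 * m%:R / rt n ^+ 3 + 16 * m%:R ^+ 4 / rt n ^+ 8.
Proof.
move=> n0 mn; set s := rt n; have s1 : 1 <= s by exact: sqrtn_ge1.
have s0 : 0 < s by lra.
have sn : s ^+ 2 = n%:R by exact: sqrtn_sqr.
have A0 : 0 <= 2 * m%:R / s ^+ 3 by rewrite divr_ge0 ?exprn_ge0 ?mulr_ge0// ltW.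
have B0 : 0 <= 16 * m%:R ^+ 4 / s ^+ 8.
  by rewrite divr_ge0 ?exprn_ge0 ?mulr_ge0 ?exprn_ge0// ltW.
have [mn2|mn2] := leqP (2 * m) n.
  by have := sqrtn_inv_diff_half n0 mn2; rewrite -/s; lra.
have mr : s ^+ 2 < 2 * m%:R by rewrite sn -natrM ltr_nat.
have B1 : 1 <= 16 * m%:R ^+ 4 / s ^+ 8.
  rewrite ler_pdivlMr ?exprn_gt0// mul1r.
  have -> : 16 * m%:R ^+ 4 = (2 * m%:R) ^+ 4 :> R by ring.
  by rewrite (_ : 8 = 2 * 4)%N// exprM lerXn2r ?nnegrE ?exprn_ge0 ?mulr_ge0// ltW.
have iv k : 0 <= (rt k)^-1 <= 1.
  rewrite invr_ge0 sqrtn_ge0 /=; case: k => [|k]; first by rewrite /rt sqrtr0 invr0.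
  by rewrite invf_le1 ?sqrtn_ge1 ?sqrtn_gt0.
by have := iv n; have := iv (n - m)%N; rewrite ler_norml -/s; lra.
Qed.

Lemma pincr_recursion n : (0 < n)%N ->
  n%:R * d n + P n.-1 = \sum_(1 <= m < n.+1) (sigma m)%:R * d (n - m).
Proof.
case: n => // n _; rewrite big_nat_recr//= subnn.
have := partR_recursion n.+1 (R := R); have := partR_recursion n (R := R).
rewrite [in X in _ -> X -> _]big_nat_recr//= subnn => h1 h2.
rewrite (eq_big_nat _ _ (F2 := fun m => (sigma m)%:R * P (n.+1 - m) - (sigma m)%:R * P (n - m))).
  rewrite sumrB -h1; have P01 : P 0 = 1 by rewrite /P p0.
  by rewrite P01 in h2; move: h2; rewrite -natr1; lra.
by move=> m /andP[m1 mn]; rewrite -mulrBr subSn.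
Qed.

(** The recursions at [n] and [n.-1] differ by a recursion for the increments.
    Divided by [n * P n], its weights [sigma m * x n m / n] have total mass one and
    mean of order [sqrt n]; the leftover term [P n.-1 / (n * P n)] and the drift
    of [c0 / sqrt n] under this average are both [O (1 / n)]. *)
Lemma rincr_err_average : exists2 D : R, 0 < D & forall n, (0 < n)%N ->
  `|E n - \sum_(1 <= m < n.+1) (sigma m)%:R * x n m / n%:R * E (n - m)| <= D / n%:R.
Proof.
have [D1 D10 h1] := sigma_moment 1; have [D4 D40 h4] := sigma_moment 4.
have c00 := @halfC_gt0 R.
exists (1 + c0 * (2 * D1 + 16 * D4)) => [|n n0].
  by rewrite addr_gt0// mulr_gt0// addr_gt0// mulr_gt0.
set s := rt n; have s1 : 1 <= s by exact: sqrtn_ge1.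
have s0 : 0 < s by lra.
have sn : s ^+ 2 = n%:R by exact: sqrtn_sqr.
have nr0 : 0 < n%:R :> R by rewrite ltr0n.
have nrn0 : n%:R != 0 :> R by rewrite gt_eqF.
have mass : \sum_(1 <= m < n.+1) (sigma m)%:R * x n m / n%:R = 1.
  by rewrite -big_distrl /= sum_kernel// divff.
have rec : r n + (1 - r n) / n%:R = \sum_(1 <= m < n.+1) (sigma m)%:R * x n m / n%:R * r (n - m).
  have Pn0 := @partR_gt0 R n.
  have -> : r n + (1 - r n) / n%:R = (n%:R * d n + P n.-1) / (n%:R * P n).
    by rewrite partR_predE// /r; field; rewrite (gt_eqF Pn0).
  rewrite pincr_recursion// big_distrl /=; apply: eq_bigr => m _.
  rewrite /x /r; field.
  by rewrite nrn0 (gt_eqF Pn0) gt_eqF// partR_gt0.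
have -> : E n - \sum_(1 <= m < n.+1) (sigma m)%:R * x n m / n%:R * E (n - m) =
    - ((1 - r n) / n%:R) + c0 * \sum_(1 <= m < n.+1)
      (sigma m)%:R * x n m / n%:R * ((rt (n - m))^-1 - (rt n)^-1).
  under [in RHS]eq_bigr do rewrite mulrBr.
  rewrite sumrB -[X in _ + c0 * (_ - X)]big_distrl /= mass mul1r.
  rewrite [X in E n - X](eq_bigr (fun m => (sigma m)%:R * x n m / n%:R * r (n - m)
    - c0 * ((sigma m)%:R * x n m / n%:R * (rt (n - m))^-1))); last first.
    by move=> m _; rewrite /E mulrBr [X in _ - X]mulrCA.
  by rewrite sumrB -rec -big_distrr /= /E; ring.
have S1 : \sum_(1 <= m < n.+1) (sigma m)%:R * x n m / n%:R * `|(rt (n - m))^-1 - (rt n)^-1|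
   <= (2 * D1 + 16 * D4) / n%:R.
  apply: le_trans (_ : (2 / (s ^+ 3 * n%:R)) * \sum_(1 <= m < n.+1) (sigma m)%:R * (x n m * m%:R ^+ 1)
    + (16 / (s ^+ 8 * n%:R)) * \sum_(1 <= m < n.+1) (sigma m)%:R * (x n m * m%:R ^+ 4) <= _).
    rewrite !big_distrr -big_split /=; apply: ler_sum_nat => m /andP[m1 mn].
    apply: le_trans (ler_wpM2l _ (sqrtn_inv_diff n0 mn)) _.
      by rewrite divr_ge0// mulr_ge0// pratio_ge0.
    rewrite -/s le_eqVlt; apply/orP; left; apply/eqP; field.
    by rewrite nrn0 gt_eqF.
  apply: le_trans (lerD (ler_wpM2l _ (h1 n n0)) (ler_wpM2l _ (h4 n n0))) _.
  - by rewrite divr_ge0// mulr_ge0// exprn_ge0// ltW.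
  - by rewrite divr_ge0// mulr_ge0// exprn_ge0// ltW.
  rewrite -/s.
  have -> : 16 / (s ^+ 8 * n%:R) * (D4 * s ^+ 6) = 16 * D4 / (s ^+ 2 * n%:R).
    by field; rewrite nrn0 gt_eqF.
  have -> : 2 / (s ^+ 3 * n%:R) * (D1 * s ^+ 3) = 2 * D1 / n%:R.
    by field; rewrite nrn0 gt_eqF.
  rewrite [leRHS]mulrDl lerD2l ler_pM2l ?mulr_gt0//.
  rewrite lef_pV2 ?posrE ?mulr_gt0 ?exprn_gt0// ler_peMl ?(ltW nr0)// sn ler1n//.
apply: le_trans (ler_normD _ _) _; rewrite [leRHS]mulrDl lerD//.
  rewrite normrN ger0_norm; last by rewrite divr_ge0// subr_ge0 rincr_le1.
  by rewrite ler_pM2r ?invr_gt0// gerBl rincr_ge0.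
rewrite normrM (gtr0_norm c00) -mulrA ler_pM2l//; apply: le_trans S1.
apply: le_trans (ler_norm_sum _ _ _) _; apply: ler_sum_nat => m _.
by rewrite normrM ger0_norm// divr_ge0// mulr_ge0// pratio_ge0.
Qed.

End relations.

(** ** The weighted relation *)

Section weights.
Context {R : realType}.
Local Notation r := (@rincr R).
Local Notation rt := (@sqrtn R).
Local Notation c0 := (@halfC R).
Local Notation x := (@pratio R).
Local Notation z := (@pgeo R).
Local Notation E := (@rincr_err R).

(** Up to the factor [x n j], the weight with which the increment at [n - j]
    enters [mass_defect]. *)
Definition sigma_tail (n j : nat) : R :=
  \sum_(j.+1 <= m < n.+1) (sigma m)%:R * z n ^+ (m - j.+1).

Local Notation V := sigma_tail.

Lemma pgeo_gt0 n : 0 < z n. Proof. exact: expR_gt0. Qed.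

Lemma pgeoX n m : z n ^+ m = expR (- (c0 / rt n * m%:R)).
Proof. by rewrite expRnat. Qed.

(** Replacing the factors [1 - r (n - j)] of [x n m] by [z n] one after the other
    keeps the comparison exactly linear in the increments: no logarithms, no
    quadratic remainder. *)
Lemma pratio_sub_pgeo n m : (m <= n)%N ->
  x n m - z n ^+ m = \sum_(0 <= j < m) x n j * z n ^+ (m - j.+1) * (1 - z n - r (n - j)).
Proof.
elim: m => [|m IHm] mn; first by rewrite big_geq// pratio0 expr0 subrr.
rewrite big_nat_recr//= subnn expr0 mulr1 pratioS// exprS.
rewrite (eq_big_nat _ _ (F2 := fun j => z n * (x n j * z n ^+ (m - j.+1) * (1 - z n - r (n - j))))).
  by rewrite -big_distrr /= -IHm ?(ltnW mn)//; ring.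
by move=> j /andP[_ jm]; rewrite subSn// exprS; ring.
Qed.

Lemma mass_defect n :
  \sum_(1 <= m < n.+1) (sigma m)%:R * (x n m - z n ^+ m) =
  \sum_(0 <= j < n) x n j * V n j * (1 - z n - r (n - j)).
Proof.
rewrite (eq_big_nat _ _ (F2 := fun m => \sum_(0 <= j < n | (j < m)%N)
   (sigma m)%:R * (x n j * z n ^+ (m - j.+1) * (1 - z n - r (n - j))))); last first.
  move=> m /andP[m1 mn]; rewrite pratio_sub_pgeo// big_distrr /= (big_nat_widen _ _ n)//.
rewrite (exchange_big_dep_nat xpredT)//=; apply: eq_big_nat => j /andP[_ jn].
rewrite /V big_distrr big_distrl /= [RHS](big_nat_widenl _ 1)//=.
by apply: eq_bigr => m jm; ring.
Qed.

Lemma harmonic_le n : \sum_(1 <= k < n.+1) k%:R^-1 <= 2 * rt n.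
Proof.
elim: n => [|n IHn]; first by rewrite big_geq// /rt sqrtr0 mulr0.
rewrite big_nat_recr//= -(sqrtn_sqr n.+1).
have b1 : 1 <= rt n.+1 by exact: sqrtn_ge1.
have ab : rt n <= rt n.+1 by exact: le_sqrtn.
have a0 : 0 <= rt n by exact: sqrtn_ge0.
have : rt n.+1 ^+ 2 = rt n ^+ 2 + 1 by rewrite !sqrtn_sqr natr1.
move: (rt n.+1) (rt n) (\sum_(_ <= _ < _) _) b1 ab a0 IHn => b a h b1 ab a0 IHn e.
have b0 : 0 < b by lra.
apply: (@le_trans _ _ (2 * a + (b ^+ 2)^-1)); first by lra.
rewrite -lerBrDl -[leLHS]mul1r ler_pdivrMr ?exprn_gt0//.
have : (b + a) * 1 <= (b + a) * ((2 * b - 2 * a) * b ^+ 2).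
  have -> : (b + a) * ((2 * b - 2 * a) * b ^+ 2) = 2 * b ^+ 2 * (b ^+ 2 - a ^+ 2) by ring.
  nra.
by rewrite ler_pM2l//; lra.
Qed.

(** Multiples of [k] beyond [j] are spaced by [k], whence the factor
    [1 + 1 / (phi * k)] in place of [1 + 1 / phi]. *)
Lemma sparse_exp_le (phi : R) k j N : 0 < phi -> (0 < k)%N ->
  \sum_(1 <= d < N.+1 | (j < k * d)%N) expR (- (phi * (k * d - j.+1)%:R))
  <= 1 + (phi * k%:R)^-1.
Proof.
move=> phi0 k0; have pk0 : 0 < phi * k%:R by rewrite mulr_gt0// ltr0n.
pose d0 := (j %/ k).+1.
have jd d : (j < k * d)%N = (d0 <= d)%N by rewrite /d0 mulnC -ltn_divLR.
under eq_bigl do rewrite jd.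
rewrite (_ : \sum_(_ <= d < _ | _) _ =
    \sum_(d0 <= d < N.+1) expR (- (phi * (k * d - j.+1)%:R))); last first.
  by rewrite [RHS](big_nat_widenl _ 1).
apply: le_trans (geo_sum_le (N.+1 - d0) pk0).
rewrite -{1}(add0n d0) big_addn; apply: ler_sum_nat => i _.
rewrite ler_expR lerN2 -mulrA ler_pM2l// -natrM ler_nat.
have : (j < k * d0)%N by rewrite jd.
by rewrite mulnDr; lia.
Qed.

(** As [sigma m] is [m] times the sum of [1 / k] over the divisors [k] of [m], the
    tail splits into sums over the multiples of [k]. By their spacing the sum over
    [k] converges, except for a harmonic sum, which is at most [2 * sqrt n]. *)
Lemma sigma_tail_le : exists2 D : R, 1 <= D & forall n j, (0 < n)%N ->
  V n j <= D * (j%:R * rt n + rt n ^+ 2).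
Proof.
have c00 := @halfC_gt0 R; have c0i : 0 < c0^-1 by rewrite invr_gt0.
pose D : R := (2 + 4 / c0) * (2 + 8 / c0).
exists D => [|n j n0].
  rewrite /D; have := mulr_gt0 c0i c0i; move: (c0^-1) c0i => u *; nra.
set s := rt n; have s1 : 1 <= s by exact: sqrtn_ge1.
have s0 : 0 < s by lra.
pose t := c0 / s; have t0 : 0 < t by rewrite divr_gt0.
have th0 : 0 < t / 2 by rewrite divr_gt0.
have ti : t^-1 = s / c0 by rewrite /t invf_div.
pose B : R := j%:R + 1 + 2 / t.
have B0 : 0 < B by rewrite /B -addrA ltr_wpDl// addr_gt0// divr_gt0.
have -> : V n j = \sum_(1 <= m < n.+1) (sigma m)%:R *
   (if (j < m)%N then z n ^+ (m - j.+1) else 0).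
  rewrite /V (big_nat_widenl _ 1)//= big_mkcond /=; apply: eq_bigr => m _.
  by case: ifP; rewrite ?mulr0.
rewrite sum_sigma.
apply: le_trans (_ : \sum_(1 <= k < n.+1) k%:R^-1 * (B * (1 + (t / 2 * k%:R)^-1)) <= _).
  apply: ler_sum_nat => k /andP[k1 _]; have k0 : 0 < k%:R :> R by rewrite ltr0n.
  apply: le_trans (ler_wpM2l _ (ler_wpM2l (ltW B0) (sparse_exp_le j n th0 k1))); last first.
    by rewrite invr_ge0.
  rewrite !big_distrr /= [leRHS]big_mkcond [leLHS]big_mkcond /=.
  apply: ler_sum => d _; case: (ltnP j (k * d)) => jd; last by rewrite mulr0 if_same.
  have H : d%:R * z n ^+ (k * d - j.+1) <=
     k%:R^-1 * (B * expR (- (t / 2 * (k * d - j.+1)%:R))).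
    set u := (k * d - j.+1)%N.
    have kdE : d%:R = k%:R^-1 * (j%:R + 1 + u%:R) :> R.
      rewrite natr1 -natrD subnKC// natrM mulrA mulVf ?mul1r// gt_eqF//.
    rewrite {1}kdE -[leLHS]mulrA ler_pM2l ?invr_gt0//.
    have -> : z n ^+ u = expR (- (t / 2 * u%:R)) * expR (- (u%:R / (2 / t))).
      rewrite pgeoX -expRD -/s -/t; congr expR; field; rewrite gt_eqF//.
    have tt0 : 0 < 2 / t by rewrite divr_gt0.
    have := @pow_exp_le R (2 / t) u%:R 1 tt0 (ler0n _ _).
    have f1 : 1`!%:R = 1 :> R by [].
    rewrite f1 mul1r !expr1.
    have := expR_gt0 (- (t / 2 * u%:R)).
    have : expR (- (u%:R / (2 / t))) <= 1.
      by rewrite -[leRHS]expR0 ler_expR oppr_le0 divr_ge0// ltW.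
    have : 0 <= j%:R :> R by [].
    rewrite /B; move: (j%:R : R) (u%:R : R) (expR (- (t / 2 * u%:R))) (expR (- (u%:R / (2 / t)))).
    move=> a b e1 e2 a0 e21 e10 h.
    have : (a + 1 + b) * e2 <= a + 1 + 2 / t by nra.
    move=> h2; rewrite mulrCA; have := ler_wpM2l (ltW e10) h2; lra.
  case: ifP => // _; apply: le_trans H.
  by rewrite mulr_ge0// exprn_ge0// ltW// pgeo_gt0.
rewrite (eq_bigr (fun k : nat => B * k%:R^-1 + B * (2 / t) * (k%:R ^+ 2)^-1)); last first.
  move=> k _; have [->|k0] := eqVneq k 0%N; first by rewrite expr0n /= invr0 !mulr0 mul0r addr0.
  have : k%:R != 0 :> R by rewrite pnatr_eq0.
  move: (k%:R : R) => a a0; field; rewrite a0 gt_eqF//.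
rewrite big_split -!big_distrr /=.
have h1 := harmonic_le n; rewrite -/s in h1.
have h2 : \sum_(1 <= k < n.+1) (k%:R ^+ 2)^-1 <= 4 :> R.
  apply: le_trans (zeta2_le R n) _; rewrite -halfC_sqr; have := @halfC_lt2 R; nra.
apply: le_trans (lerD (ler_wpM2l (ltW B0) h1) (ler_wpM2l _ h2)) _.
  by rewrite mulr_ge0// ltW// divr_gt0.
rewrite /B ti /D; have : 0 <= j%:R :> R by [].
move: (c0^-1) (j%:R : R) c0i => g a g0 a0.
have : (a + 1 + 2 * (s * g)) <= (2 + 4 * g) * (a + s) by nra.
have G : 0 < (2 + 8 * g) * s by nra.
move=> h; have := ler_wpM2r (ltW G) h.
have -> : (2 + 4 * g) * (a + s) * ((2 + 8 * g) * s) = (2 + 4 * g) * (2 + 8 * g) * (a * s + s ^+ 2) by ring.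
apply: le_trans; rewrite le_eqVlt; apply/orP; left; apply/eqP; ring.
Qed.

(** The first [sqrt n] terms of the tail are at least [1, 2, 3, ...] up to a
    constant. *)
Lemma sigma_tail_ge n j : (4 <= n)%N -> (2 * j <= n)%N -> rt n ^+ 2 / 128 <= V n j.
Proof.
move=> n4 jn; have n0 : (0 < n)%N by lia.
have := @nat_sqrtn R n n0; set s := rt n => -[K K0 /andP[Ks sK]].
have s1 : 1 <= s by exact: sqrtn_ge1.
have sn : s ^+ 2 = n%:R by exact: sqrtn_sqr.
have K1 : 1 <= K%:R :> R by rewrite ler1n.
have KS : K.+1%:R = K%:R + 1 :> R by rewrite natr1.
have n4r : 4 <= s ^+ 2 by rewrite sn ler_nat.
have Kn : (K <= n - j)%N.
  have : (2 * K <= n)%N by rewrite -(ler_nat R) natrM -sn; nra.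
  lia.
have Kn2 : (j + K < n.+1)%N by lia.
rewrite /V (big_cat_nat (n := (j + K).+1))//=; last by lia.
apply: le_trans (_ : \sum_(j.+1 <= m < (j + K).+1) (sigma m)%:R * z n ^+ (m - j.+1) <= _); last first.
  by rewrite lerDl sumr_ge0// => m _; rewrite mulr_ge0// exprn_ge0// ltW// pgeo_gt0.
apply: le_trans (_ : \sum_(1 <= m < K.+1) m%:R / 16 <= _).
  rewrite -big_distrl /=; have := @sum_id_ge R K.
  move: (\sum_(_ <= _ < _) _) => S hS; nra.
rewrite -(add1n j) big_addn.
have -> : ((j + K).+1 - j = K.+1)%N by lia.
apply: ler_sum_nat => m /andP[m1 mK]; apply: ler_pM => //.
  apply: le_trans (_ : (m + j)%:R <= _); first by rewrite ler_nat leq_addr.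
  by rewrite sigma_ge// addn_gt0 m1.
rewrite pgeoX.
have : expR 1 ^+ 2 <= 16 :> R.
  have := @expR1_le4 R; have := expR_gt0 (1 : R); move: (expR _) => u *; nra.
rewrite -expRM_natl mulr1 => e16.
apply: le_trans (_ : expR (- 2) <= _).
  by rewrite -[leLHS]mul1r ler_pdivrMr// expRN -ler_pdivrMl ?invr_gt0 ?expR_gt0// invrK mulr1.
rewrite ler_expR lerN2 -/s mulrAC ler_pdivrMr//; last by lra.
apply: ler_pM => //; first exact: ltW (@halfC_gt0 R).
  exact: ltW (@halfC_lt2 R).
by apply: le_trans Ks; rewrite ler_nat; lia.
Qed.

Lemma one_sub_pgeo n : (0 < n)%N -> `|1 - z n - c0 / rt n| <= 4 / n%:R.
Proof.
move=> n0; have s0 : 0 < rt n by exact: sqrtn_gt0.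
rewrite -(sqrtn_sqr n) /z; set t := c0 / rt n; have t0 : 0 < t by rewrite divr_gt0 ?halfC_gt0.
have t2 : t ^+ 2 <= 4 / rt n ^+ 2.
  rewrite /t expr_div_n ler_pM2r ?invr_gt0 ?exprn_gt0//.
  by have := @halfC_lt2 R; have := @halfC_gt0 R; move: c0 => c *; nra.
have h1 := expR_ge1Dx (- t).
have h2 := expRN_mul_le1 t.
have t10 : 0 < 1 + t by lra.
have h3 : expR (- t) <= 1 - t + t ^+ 2.
  rewrite -(ler_pM2r t10); apply: le_trans h2 _.
  have -> : (1 - t + t ^+ 2) * (1 + t) = 1 + t ^+ 3 by ring.
  by rewrite lerDl exprn_ge0// ltW.
by rewrite ler_norml; apply/andP; split; lra.
Qed.

(** The recursion evaluates the sum of [sigma m * x n m] as [n], and the Basel sum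
    evaluates that of [sigma m * z n ^+ m] as [n + O (sqrt n)]. Hence the linear
    form of [mass_defect] is [O (sqrt n)]; its coefficients are positive, so it
    tests the size of the errors, not only their variation. *)
Lemma rincr_err_weighted : exists2 D : R, 0 < D & forall n, (0 < n)%N ->
  `|\sum_(0 <= j < n) x n j * V n j * E (n - j)| <= D * rt n.
Proof.
have [Ds Ds0 hs] := @sigma_exp_ge R; have [D D1 hV] := sigma_tail_le.
have [m0 m00 h0] := @pratio_moment R 0; have [m1 m10 h1] := @pratio_moment R 1.
have [m2 m20 h2] := @pratio_moment R 2; have [m4 m40 h4] := @pratio_moment R 4.
have [m5 m50 h5] := @pratio_moment R 5.
have c00 := @halfC_gt0 R; have c2 := @halfC_lt2 R.
exists (Ds + D * (4 * (m0 + m1) + 4 * (m1 + m2) + 32 * (m4 + m5))) => [|n n0].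
  by rewrite addr_gt0// mulr_gt0 ?(lt_le_trans ltr01 D1)// !addr_gt0// mulr_gt0// addr_gt0.
set s := rt n; have s1 : 1 <= s by exact: sqrtn_ge1.
have s0 : 0 < s by lra.
have sn : s ^+ 2 = n%:R by exact: sqrtn_sqr.
have nr0 : 0 < n%:R :> R by rewrite ltr0n.
have V0 j : 0 <= V n j by apply: sumr_ge0 => m _; rewrite mulr_ge0// exprn_ge0// ltW// pgeo_gt0.
have -> : \sum_(0 <= j < n) x n j * V n j * E (n - j) =
   - \sum_(1 <= m < n.+1) (sigma m)%:R * (x n m - z n ^+ m) +
   \sum_(0 <= j < n) x n j * V n j * (1 - z n - c0 / rt (n - j)).
  by rewrite mass_defect -sumrN -big_split /=; apply: eq_bigr => j _; rewrite /E; ring.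
have defect : `|\sum_(1 <= m < n.+1) (sigma m)%:R * (x n m - z n ^+ m)| <= Ds * s.
  under eq_bigr do rewrite mulrBr.
  rewrite sumrB sum_kernel//.
  have -> : \sum_(1 <= m < n.+1) (sigma m)%:R * z n ^+ m =
      \sum_(1 <= m < n.+1) (sigma m)%:R * expR (- (c0 / s * m%:R)).
    by apply: eq_bigr => m _; rewrite pgeoX.
  have t0 : 0 < c0 / s by rewrite divr_gt0.
  have lb := hs n n0; have ub := sigma_exp_le n t0.
  rewrite (_ : c0 ^+ 2 / (c0 / s) ^+ 2 = n%:R) in ub; last first.
    by rewrite -sn; field; rewrite !gt_eqF.
  by rewrite -/s in lb; rewrite ler_norml; have := mulr_gt0 Ds0 s0; lra.
have rest : \sum_(0 <= j < n) x n j * V n j * `|1 - z n - c0 / rt (n - j)| <=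
    D * (4 * (m0 + m1) + 4 * (m1 + m2) + 32 * (m4 + m5)) * s.
  apply: le_trans (_ : \sum_(0 <= j < n.+1)
     (D * 4 * (x n j * j%:R ^+ 0) + D * (4 / s + 4 / s) * (x n j * j%:R ^+ 1)
     + D * (4 / s ^+ 2) * (x n j * j%:R ^+ 2) + D * (32 / s ^+ 6) * (x n j * j%:R ^+ 4)
     + D * (32 / s ^+ 7) * (x n j * j%:R ^+ 5)) <= _).
    rewrite [leRHS]big_nat_recr//= -[leLHS]addr0 lerD//; last first.
      have D0 : 0 <= D by lra.
      have s0' := ltW s0.
      by rewrite !addr_ge0// !mulr_ge0 ?pratio_ge0 ?exprn_ge0 ?invr_ge0 ?exprn_ge0 ?addr_ge0 ?invr_ge0//; apply: mulr_ge0; rewrite ?invr_ge0.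
    apply: ler_sum_nat => j /andP[_ jn].
    have e1 : `|1 - z n - c0 / rt (n - j)| <= 4 / s ^+ 2 + 4 * j%:R / s ^+ 3 + 32 * j%:R ^+ 4 / s ^+ 8.
      have := one_sub_pgeo n0; have := @sqrtn_inv_diff R n j n0 (ltnW jn); rewrite -sn -/s.
      set a := (rt (n - j))^-1; set b := s^-1; set u := 2 * j%:R / s ^+ 3.
      set v := 16 * j%:R ^+ 4 / s ^+ 8 => i1 i2.
      have -> : 4 * j%:R / s ^+ 3 = 2 * u by rewrite /u; ring.
      have -> : 32 * j%:R ^+ 4 / s ^+ 8 = 2 * v by rewrite /v; ring.
      have -> : 1 - z n - c0 * a = (1 - z n - c0 * b) - c0 * (a - b) by ring.
      apply: le_trans (ler_normB _ _) _; rewrite normrM (gtr0_norm c00).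
      have : c0 * `|a - b| <= 2 * `|a - b| by rewrite ler_wpM2r// ltW.
      lra.
    apply: le_trans (ler_wpM2l _ e1) _; first by rewrite mulr_ge0// pratio_ge0.
    have e3 : 0 <= 4 / s ^+ 2 + 4 * j%:R / s ^+ 3 + 32 * j%:R ^+ 4 / s ^+ 8 by apply: le_trans e1.
    apply: le_trans (ler_wpM2r e3 (ler_wpM2l (pratio_ge0 n j) (hV n j n0))) _.
    rewrite -/s; move: (j%:R : R) (x n j) => a b.
    by rewrite le_eqVlt; apply/orP; left; apply/eqP; field; rewrite gt_eqF.
  rewrite !big_split /= -!big_distrr /=.
  have D0 : 0 <= D by lra.
  have s0' := ltW s0.
  have i0 k (c : R) : 0 <= c -> 0 <= D * (c / s ^+ k).
    by move=> c_ge0; rewrite mulr_ge0// divr_ge0// exprn_ge0.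
  have k0 : D * 4 * \sum_(0 <= j < n.+1) x n j * j%:R ^+ 0 <= D * 4 * (m0 * s ^+ 1).
    by rewrite ler_wpM2l ?h0// mulr_ge0.
  have k1 : D * (4 / s + 4 / s) * \sum_(0 <= j < n.+1) x n j * j%:R ^+ 1 <= D * (4 / s + 4 / s) * (m1 * s ^+ 2).
    by rewrite ler_wpM2l ?h1// mulr_ge0// addr_ge0// divr_ge0.
  have k2 := ler_wpM2l (i0 2%N 4 (ler0n _ _)) (h2 n n0).
  have k4 := ler_wpM2l (i0 6%N 32 (ler0n _ _)) (h4 n n0).
  have k5 := ler_wpM2l (i0 7%N 32 (ler0n _ _)) (h5 n n0).
  rewrite -/s in k2 k4 k5.
  apply: le_trans (lerD (lerD (lerD (lerD k0 k1) k2) k4) k5) _.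
  rewrite (_ : _ + D * (32 / s ^+ 7) * (m5 * s ^+ 6) =
    D * (4 * (m0 + m1) + 4 * (m1 + m2)) * s + D * (32 * (m4 + m5)) * s^-1); last first.
    by field; rewrite gt_eqF.
  have si : s^-1 <= s by rewrite (le_trans _ s1)// invf_le1.
  have M0 : 0 <= D * (32 * (m4 + m5)) by rewrite mulr_ge0// mulr_ge0// addr_ge0// ?(ltW m40) ?(ltW m50).
  by have := ler_wpM2l M0 si; lra.
apply: le_trans (ler_normD _ _) _; rewrite normrN [leRHS]mulrDl lerD//.
apply: le_trans rest; apply: le_trans (ler_norm_sum _ _ _) _; apply: ler_sum_nat => j _.
by rewrite normrM ger0_norm// mulr_ge0 ?pratio_ge0.
Qed.

End weights.

(** * The rate of convergence of the increments *)

Section rate.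
Context {R : realType}.
Local Notation rt := (@sqrtn R).
Local Notation x := (@pratio R).
Local Notation V := (@sigma_tail R).
Local Notation E := (@rincr_err R).

Lemma count_below (L c : R) N : 0 <= L -> 0 <= c ->
  \sum_(1 <= m < N.+1) (if m%:R < L then c else 0) <= L * c.
Proof.
move=> L0 c0.
suff : \sum_(1 <= m < N.+1) (if m%:R < L then c else 0) <= L * c /\
  \sum_(1 <= m < N.+1) (if m%:R < L then c else 0) <= N%:R * c by case.
elim: N => [|N [IH1 IH2]]; first by rewrite big_geq// mul0r mulr_ge0.
rewrite big_nat_recr//= -natr1 mulrDl mul1r; case: ltP => h; last first.
  by rewrite addr0; split => //; lra.
by split; [have := ler_wpM2r c0 (ltW h)|]; lra.
Qed.

Lemma pratio_ge n m : (0 < n)%N -> 16 * m%:R <= rt n -> 800^-1 <= x n m.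
Proof.
move=> n0 ms; have s1 : 1 <= rt n by exact: sqrtn_ge1.
have sn : rt n ^+ 2 = n%:R by exact: sqrtn_sqr.
have m4 : (4 * m <= n)%N.
  by rewrite -(ler_nat R) natrM -sn; have : 0 <= m%:R :> R by []; nra.
have nm : (0 < n - m)%N by lia.
have h : m%:R <= rt (n - m) / 8.
  have a2 : rt (n - m) ^+ 2 = rt n ^+ 2 - m%:R by rewrite !sqrtn_sqr natrB//; lia.
  have m4r : 4 * m%:R <= rt n ^+ 2 by rewrite sn -natrM ler_nat.
  have a0 : 0 <= rt (n - m) by exact: sqrtn_ge0.
  have : rt n <= 2 * rt (n - m) by nra.
  lra.
have := partR_add_le nm h; rewrite subnK; last by lia.
move=> hP; have h8 : 0 < 800 :> R by lra.
rewrite /x ler_pdivlMr; last exact: partR_gt0.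
by rewrite ler_pdivrMl; [exact: hP|exact: h8].
Qed.

Lemma sigma_tail_ge0 n j : 0 <= V n j.
Proof. by apply: sumr_ge0 => m _; rewrite mulr_ge0// exprn_ge0// ltW// pgeo_gt0. Qed.

(** The [m] up to [sqrt n / 16] suffice: there [x] is bounded below and [V] has
    order [n]. *)
Lemma sum_weights_ge : exists2 tau : R, 0 < tau <= 1 & forall n, (1024 <= n)%N ->
  tau * rt n ^+ 3 <= \sum_(1 <= m < n.+1) x n m * V n m.
Proof.
(* At least [s / 32] terms, each at least [1 / 800] times [s^2 / 128]. *)
exists (800^-1 / 128 / 32) => [|n n1]; first by lra.
have n0 : (0 < n)%N by apply: leq_trans n1.
set s := rt n; have s1 : 1 <= s by exact: sqrtn_ge1.
have sn : s ^+ 2 = n%:R by exact: sqrtn_sqr.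
have s32 : 32 <= s.
  have : 1024 <= s ^+ 2 by rewrite sn ler_nat.
  nra.
pose K := Num.truncn (s / 16).
have s16 : 0 <= s / 16 by lra.
have /andP[K1 K2] := truncn_itv s16; rewrite -/K in K1 K2.
have KS : K.+1%:R = K%:R + 1 :> R by rewrite natr1.
have K3 : s / 32 <= K%:R by rewrite KS in K2; lra.
have K4 : (4 * K <= n)%N by rewrite -(ler_nat R) natrM -sn; nra.
rewrite (big_cat_nat (n := K.+1))//=; last by lia.
apply: le_trans (_ : \sum_(1 <= m < K.+1) x n m * V n m <= _); last first.
  by rewrite lerDl sumr_ge0// => m _; rewrite mulr_ge0// ?pratio_ge0 ?sigma_tail_ge0.
apply: le_trans (_ : \sum_(1 <= m < K.+1) 800^-1 * (s ^+ 2 / 128) <= _).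
  rewrite sumr_const_nat subSS subn0 -[_ *+ K]mulr_natr exprS.
  have : 0 < s ^+ 2 by rewrite exprn_gt0//; lra.
  move: (s ^+ 2) => u u0; nra.
apply: ler_sum_nat => m /andP[m1 mK].
have mKr : m%:R <= K%:R :> R by rewrite ler_nat; lia.
apply: ler_pM.
- lra.
- by have := sqr_ge0 s; lra.
- by apply: pratio_ge => //; rewrite -/s; lra.
- by apply: sigma_tail_ge; lia.
Qed.

(** Subtracting a multiple of the weights [x * V] from the averaging kernel
    removes a fixed proportion of its mass: the two are comparable except for
    [m] small against [sqrt n], a range that carries only second-order mass. *)
Lemma rincr_err_contraction : exists (wt : nat -> nat -> R) (delta D : R) (N0 : nat),
  [/\ 0 < delta < 1, 0 < D & forall n, (N0 <= n)%N ->
    [/\ (0 < n)%N, (forall m, 0 <= wt n m),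
      \sum_(1 <= m < n.+1) wt n m <= 1 - delta,
      \sum_(1 <= m < n.+1) wt n m * m%:R ^+ 4 <= D * rt n ^+ 4 &
      `|E n| <= \sum_(1 <= m < n.+1) wt n m * `|E (n - m)| + D / n%:R]].
Proof.
have [Da Da0 hA] := @rincr_err_average R; have [Dw Dw0 hW] := @rincr_err_weighted R.
have [Dv Dv1 hV] := @sigma_tail_le R; have [tau /andP[tau0 tau1] hT] := sum_weights_ge.
have [D4 D40 h4] := @sigma_moment R 4; have [m4 m40 hm4] := @pratio_moment R 4.
have [m5 m50 hm5] := @pratio_moment R 5.
have [Ke Ke0 hK] : exists2 K : R, 0 < K & forall n, (0 < n)%N -> `|E n| <= K / rt n.
  by exists 12802; [lra|exact: rincr_err_le_sqrtn].
have Dv0 : 0 < Dv by lra.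
have DK0 : 0 < 2 * Dv * Ke by rewrite mulr_gt0// mulr_gt0.
(* Then the second-order loss [8 * beta^2 * Dv^2] is half the gain [beta * tau]. *)
pose beta := tau / (16 * Dv ^+ 2).
have beta0 : 0 < beta by rewrite divr_gt0// mulr_gt0// exprn_gt0.
have bDD : beta * Dv ^+ 2 = tau / 16 by rewrite /beta; field; rewrite gt_eqF.
have bD0 : 0 < beta * Dv by rewrite mulr_gt0.
have bD : beta * Dv <= 2^-1 by nra.
have b1 : beta <= 1 by nra.
pose a n m : R := (sigma m)%:R * x n m / n%:R.
pose b n m : R := beta / rt n ^+ 3 * (x n m * V n m).
exists (fun n m => `|a n m - b n m|), (beta * tau / 2),
  (Da + beta * Dw + 2 * Dv * Ke + (D4 + beta * Dv * (m4 + m5))), 1024%N; split.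
- have := mulr_gt0 beta0 tau0 => h; rewrite divr_gt0//=; nra.
- have := mulr_gt0 beta0 Dw0; have := mulr_gt0 bD0 (addr_gt0 m40 m50); lra.
move=> n n1; have n0 : (0 < n)%N by apply: leq_trans n1.
set s := rt n; have s1 : 1 <= s by exact: sqrtn_ge1.
have s0 : 0 < s by lra.
have sn : s ^+ 2 = n%:R by exact: sqrtn_sqr.
have nr0 : 0 < n%:R :> R by rewrite ltr0n.
have a0 m : 0 <= a n m by rewrite divr_ge0// mulr_ge0// pratio_ge0.
have b0 m : 0 <= b n m.
  apply: mulr_ge0; last by rewrite mulr_ge0 ?pratio_ge0 ?sigma_tail_ge0.
  by apply: divr_ge0; [exact: ltW|rewrite exprn_ge0// ltW].
have suma : \sum_(1 <= m < n.+1) a n m = 1.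
  by rewrite /a -big_distrl /= sum_kernel// divff// gt_eqF.
have b_le m : b n m <= beta * Dv / s ^+ 3 * (x n m * (m%:R * s + s ^+ 2)).
  rewrite /b -/s; have := ler_wpM2l (pratio_ge0 n m) (hV n m n0); rewrite -/s => h.
  have c0 : 0 <= beta / s ^+ 3 by rewrite divr_ge0 ?exprn_ge0 ?ltW.
  apply: le_trans (ler_wpM2l c0 h) _.
  by rewrite le_eqVlt; apply/orP; left; apply/eqP; field; rewrite gt_eqF.
split => //.
(* Below [L] the subtracted weight may exceed the kernel, by at most [c / 2]. *)
- pose L := 2 * (beta * Dv) * s; pose c := 4 * (beta * Dv) / s.
  have L0 : 0 <= L by apply: mulr_ge0; [rewrite mulr_ge0// ltW|exact: ltW].
  have c0 : 0 <= c by apply: divr_ge0; [rewrite mulr_ge0// ltW|exact: ltW].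
  apply: le_trans (_ : \sum_(1 <= m < n.+1) (a n m - b n m + (if m%:R < L then c else 0)) <= _).
    apply: ler_sum_nat => m /andP[m1 mn].
    have xm0 := pratio_ge0 (R := R) n m; have xm1 := @pratio_le1 R n m.
    case: ltP => hm.
      suff : b n m <= c / 2 by have := a0 m; have := b0 m; rewrite ler_norml; lra.
      apply: le_trans (b_le m) _.
      have h : m%:R * s + s ^+ 2 <= 2 * s ^+ 2.
        have : m%:R <= s by move: hm; rewrite /L; nra.
        by move=> h; rewrite mulr2n mulrDl mul1r lerD2r expr2 ler_pM2r.
      have h' : x n m * (m%:R * s + s ^+ 2) <= 1 * (2 * s ^+ 2).
        by apply: ler_pM => //; rewrite addr_ge0// ?mulr_ge0// ?exprn_ge0// ltW.
      have cc0 : 0 <= beta * Dv / s ^+ 3 by rewrite divr_ge0 ?exprn_ge0 ?ltW.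
      apply: le_trans (ler_wpM2l cc0 h') _.
      by rewrite /c le_eqVlt; apply/orP; left; apply/eqP; field; rewrite gt_eqF.
    rewrite addr0 ger0_norm// subr_ge0; apply: le_trans (b_le m) _.
    have -> : beta * Dv / s ^+ 3 * (x n m * (m%:R * s + s ^+ 2)) =
       x n m / n%:R * (beta * Dv * (m%:R + s)).
      by rewrite -sn; field; rewrite gt_eqF.
    have -> : a n m = x n m / n%:R * (sigma m)%:R by rewrite /a; ring.
    apply: ler_wpM2l; first by rewrite divr_ge0.
    apply: le_trans _ (@sigma_ge R m m1).
    have m0 : 0 <= m%:R :> R by [].
    by have := ler_wpM2r m0 bD; move: hm; rewrite /L; lra.
  rewrite big_split /= sumrB suma.
  have := count_below n L0 c0.
  have -> : L * c = 8 * beta * (beta * Dv ^+ 2).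
    by rewrite /L /c; field; rewrite gt_eqF.
  rewrite bDD; have : beta * tau <= \sum_(1 <= m < n.+1) b n m.
    rewrite /b -big_distrr /= -/s; have := hT n n1; rewrite -/s => h.
    have cc0 : 0 <= beta / s ^+ 3 by rewrite divr_ge0 ?exprn_ge0 ?ltW.
    apply: le_trans (ler_wpM2l cc0 h).
    by rewrite le_eqVlt; apply/orP; left; apply/eqP; field; rewrite gt_eqF.
  lra.
- apply: le_trans (_ : \sum_(1 <= m < n.+1) (a n m * m%:R ^+ 4 + b n m * m%:R ^+ 4) <= _).
    apply: ler_sum_nat => m _; rewrite -mulrDl ler_wpM2r ?exprn_ge0//.
    by rewrite ler_norml; have := a0 m; have := b0 m; lra.
  rewrite big_split /=.
  have ha : \sum_(1 <= m < n.+1) a n m * m%:R ^+ 4 <= D4 * s ^+ 4.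
    rewrite (eq_bigr (fun m => (n%:R)^-1 * ((sigma m)%:R * (x n m * m%:R ^+ 4)))); last first.
      by move=> m _; rewrite /a; ring.
    rewrite -big_distrr /= ler_pdivrMl// -sn.
    apply: le_trans (h4 n n0) _; rewrite -/s.
    by rewrite le_eqVlt; apply/orP; left; apply/eqP; ring.
  have hb : \sum_(1 <= m < n.+1) b n m * m%:R ^+ 4 <= beta * Dv * (m4 + m5) * s ^+ 4.
    apply: le_trans (_ : \sum_(0 <= m < n.+1) (beta * Dv / s ^+ 2 * (x n m * m%:R ^+ 5)
       + beta * Dv / s * (x n m * m%:R ^+ 4)) <= _).
      rewrite [leRHS]big_nat_recl//= -[leLHS]add0r lerD//.
        by rewrite !expr0n /= !mulr0 addr0.
      rewrite big_add1 /=; apply: ler_sum_nat => m _.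
      apply: le_trans (ler_wpM2r _ (b_le m.+1)) _; first by rewrite exprn_ge0.
      by rewrite le_eqVlt; apply/orP; left; apply/eqP; field; rewrite gt_eqF.
    rewrite big_split -!big_distrr /=.
    have e1 : 0 <= beta * Dv / s ^+ 2 by rewrite divr_ge0 ?exprn_ge0 ?ltW.
    have e2 : 0 <= beta * Dv / s by rewrite divr_ge0 ?ltW.
    apply: le_trans (lerD (ler_wpM2l e1 (hm5 n n0)) (ler_wpM2l e2 (hm4 n n0))) _.
    by rewrite -/s le_eqVlt; apply/orP; left; apply/eqP; field; rewrite gt_eqF.
  have : 0 <= (Da + beta * Dw + 2 * Dv * Ke) * s ^+ 4.
    by rewrite mulr_ge0 ?exprn_ge0 ?(ltW s0)//; have := mulr_gt0 beta0 Dw0; lra.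
  lra.
- have key : E n = (E n - \sum_(1 <= m < n.+1) a n m * E (n - m)) +
     beta / s ^+ 3 * \sum_(0 <= j < n) x n j * V n j * E (n - j) - b n 0 * E n
     + \sum_(1 <= m < n.+1) (a n m - b n m) * E (n - m).
    under [in X in _ + X]eq_bigr do rewrite mulrBl.
    rewrite sumrB.
    have -> : beta / s ^+ 3 * \sum_(0 <= j < n) x n j * V n j * E (n - j) =
       b n 0 * E n + \sum_(1 <= m < n.+1) b n m * E (n - m).
      rewrite big_distrr /= -[X in b n 0 * E X](subn0 n) big_add1 /=.
      rewrite -(big_nat_recl n 0%N (fun m => b n m * E (n - m)))// big_nat_recr//=.
      rewrite [X in _ = _ + X](_ : _ = 0) ?addr0.
        by apply: eq_bigr => m _; rewrite /b -/s mulrA.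
      by rewrite /b /V big_geq// !mulr0 mul0r.
    by ring.
  rewrite {1}key; apply: le_trans (ler_normD _ _) _.
  rewrite addrC lerD//.
    apply: le_trans (ler_norm_sum _ _ _) _; apply: ler_sum_nat => m _.
    by rewrite normrM.
  apply: le_trans (ler_normB _ _) _; apply: le_trans (lerD (ler_normD _ _) (lexx _)) _.
  have i1 := hA n n0.
  have i2 : `|beta / s ^+ 3 * \sum_(0 <= j < n) x n j * V n j * E (n - j)| <= beta * Dw / n%:R.
    have cc0 : 0 <= beta / s ^+ 3 by rewrite divr_ge0 ?exprn_ge0 ?ltW.
    rewrite normrM (ger0_norm cc0); apply: le_trans (ler_wpM2l cc0 (hW n n0)) _.
    by rewrite -/s -sn le_eqVlt; apply/orP; left; apply/eqP; field; rewrite gt_eqF.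
  have i3 : `|b n 0 * E n| <= 2 * Dv * Ke / n%:R.
    rewrite normrM (ger0_norm (b0 0%N)).
    have h : b n 0 <= 2 * Dv / s.
      apply: le_trans (b_le 0%N) _; rewrite pratio0 mul0r add0r mul1r.
      have -> : beta * Dv / s ^+ 3 * s ^+ 2 = beta * (Dv / s) by field; rewrite gt_eqF.
      have : 0 < Dv / s by rewrite divr_gt0.
      move=> u0; have -> : 2 * Dv / s = 2 * (Dv / s) by ring.
      by move: (Dv / s) u0 => u u0; nra.
    apply: le_trans (ler_pM (b0 0%N) (normr_ge0 _) h (hK n n0)) _.
    by rewrite -/s -sn le_eqVlt; apply/orP; left; apply/eqP; field; rewrite gt_eqF.
  have : 0 <= (D4 + beta * Dv * (m4 + m5)) / n%:R.
    rewrite divr_ge0// ltW//; have := mulr_gt0 bD0 (addr_gt0 m40 m50); lra.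
  lra.
Qed.

(** Strong induction: in the contracted average the bound at [n - m] exceeds the
    bound at [n] by a factor close to one when [m] is at most a small multiple of
    [n], and the larger [m] have negligible weight. *)
Lemma rincr_err_rate : exists2 B : R, 0 < B & forall n, (0 < n)%N ->
  `|E n| <= B / (rt n * Num.sqrt (rt n)).
Proof.
have [wt [delta [D [N0 [/andP[d0 d1] D0 hwt]]]]] := rincr_err_contraction.
(* With this choice [(1 - delta) / (1 - eta) <= 1 - eta], which leaves a
   proportion [eta] of the bound for the error terms. *)
pose eta := delta / 2.
have eta0 : 0 < eta by rewrite divr_gt0.
have eta1 : eta < 2^-1 by rewrite /eta; lra.
pose D' := D + 3 * D / eta ^+ 4.
have D'0 : 0 < D' by rewrite addr_gt0// divr_gt0 ?exprn_gt0// mulr_gt0.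
pose B := 3 * N0%:R + 2 * D' / delta.
have B0 : 0 < B.
  by rewrite ltr_wpDl ?mulr_ge0// divr_gt0// mulr_gt0.
exists B => //.
elim/ltn_ind => n IHn n0.
set s := rt n; have s1 : 1 <= s by exact: sqrtn_ge1.
have s0 : 0 < s by lra.
have sn : s ^+ 2 = n%:R by exact: sqrtn_sqr.
set q := Num.sqrt s; have q1 : 1 <= q by rewrite -[1]sqrtr1 ler_wsqrtr.
have q0 : 0 < q by lra.
have qs : q ^+ 2 = s by rewrite sqr_sqrtr// ltW.
have qls : q <= s by rewrite -qs expr2 ler_peMr// ltW.
have nr0 : 0 < n%:R :> R by rewrite ltr0n.
have sqn : s * q <= n%:R by rewrite -sn expr2 ler_pM2l.
have [nN|nN] := ltnP n N0.
  apply: le_trans (rincr_err_le3 n) _; rewrite ler_pdivlMr ?mulr_gt0//.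
  have : n%:R <= N0%:R :> R by rewrite ler_nat ltnW.
  have : 0 < 2 * D' / delta by rewrite divr_gt0// mulr_gt0.
  by rewrite /B; lra.
have [_ w0 wsum w4 hE] := hwt n nN.
have sq0 : 0 < s * q by rewrite mulr_gt0.
have G m : (1 <= m < n.+1)%N ->
    `|E (n - m)| <= B / ((1 - eta) * (s * q)) + 3 * m%:R ^+ 4 / (eta * s ^+ 2) ^+ 4.
  move=> /andP[m1 mn].
  have es0 : 0 < eta * s ^+ 2 by rewrite mulr_gt0// exprn_gt0.
  have t1 : 0 <= B / ((1 - eta) * (s * q)).
    by rewrite divr_ge0 ?(ltW B0)// mulr_ge0 ?(ltW sq0)//; lra.
  have t2 : 0 <= 3 * m%:R ^+ 4 / (eta * s ^+ 2) ^+ 4.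
    by rewrite divr_ge0 ?mulr_ge0 ?exprn_ge0// ltW.
  have [hm|hm] := leP m%:R (eta * s ^+ 2); last first.
    apply: le_trans (rincr_err_le3 _) _; rewrite -[leLHS]add0r lerD//.
    rewrite ler_pdivlMr ?exprn_gt0// ler_pM2l// lerXn2r ?nnegrE ?(ltW hm)// ltW//.
  have nm : (0 < n - m)%N.
    rewrite subn_gt0 -(ltr_nat R) -sn; apply: le_lt_trans hm _.
    have : 0 < s ^+ 2 by rewrite exprn_gt0.
    by move: (s ^+ 2) => u u0; nra.
  have nm' : (n - m < n)%N by rewrite ltn_subrL m1 n0.
  apply: le_trans (IHn _ nm' nm) _; apply: le_trans (_ : B / ((1 - eta) * (s * q)) <= _); last by lra.
  have e0 : 0 < 1 - eta by lra.
  have a0 : 0 < rt (n - m) by exact: sqrtn_gt0.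
  have c0 : 0 < Num.sqrt (rt (n - m)) by rewrite sqrtr_gt0.
  rewrite ler_pM2l// lef_pV2 ?posrE ?mulr_gt0//.
  have rs : Num.sqrt (1 - eta) * s <= rt (n - m).
    rewrite -(ler_pXn2r (isT : 0 < 2)%N) ?nnegrE ?mulr_ge0 ?sqrtr_ge0 ?(ltW s0)//.
    rewrite exprMn sqr_sqrtr ?(ltW e0)// (sqrtn_sqr (n - m)) natrB; last exact: mn.
    by rewrite -sn; lra.
  set h := Num.sqrt (1 - eta) in rs *.
  have h0 : 0 < h by rewrite sqrtr_gt0.
  have h2 : h ^+ 2 = 1 - eta by rewrite sqr_sqrtr// ltW.
  have h1 : h <= 1 by rewrite -[leRHS]sqrtr1 ler_wsqrtr//; lra.
  have rq : h * q <= Num.sqrt (rt (n - m)).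
    apply: le_trans (_ : Num.sqrt (h * s) <= _); last by rewrite ler_wsqrtr.
    rewrite sqrtrM ?(ltW h0)// ler_pM2r//.
    have g0 := sqrtr_ge0 h; have g2 := sqr_sqrtr (ltW h0).
    have g1 : Num.sqrt h <= 1 by rewrite -[leRHS]sqrtr1 ler_wsqrtr.
    by rewrite -{1}g2 expr2 ler_piMl.
  have -> : (1 - eta) * (s * q) = (h * s) * (h * q) by rewrite -h2; ring.
  by apply: ler_pM => //; rewrite mulr_ge0// ltW.
apply: le_trans hE _.
have step : \sum_(1 <= m < n.+1) wt n m * `|E (n - m)| <=
    B / ((1 - eta) * (s * q)) * (1 - delta) + 3 * D / eta ^+ 4 / n%:R.
  apply: le_trans (_ : \sum_(1 <= m < n.+1) (B / ((1 - eta) * (s * q)) * wt n m +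
     3 / (eta * s ^+ 2) ^+ 4 * (wt n m * m%:R ^+ 4)) <= _).
    apply: ler_sum_nat => m hm; apply: le_trans (ler_wpM2l (w0 m) (G m hm)) _.
    by rewrite le_eqVlt; apply/orP; left; apply/eqP; ring.
  rewrite big_split -!big_distrr /=.
  have t1 : 0 <= B / ((1 - eta) * (s * q)).
    by rewrite divr_ge0 ?(ltW B0)// mulr_ge0 ?(ltW sq0)//; lra.
  have t2 : 0 <= 3 / (eta * s ^+ 2) ^+ 4.
    by rewrite divr_ge0 ?exprn_ge0// mulr_ge0 ?exprn_ge0 ?(ltW s0) ?(ltW eta0).
  apply: le_trans (lerD (ler_wpM2l t1 wsum) (ler_wpM2l t2 w4)) _.
  rewrite -/s lerD2l -sn.
  have -> : 3 / (eta * s ^+ 2) ^+ 4 * (D * s ^+ 4) = 3 * D / eta ^+ 4 / s ^+ 4.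
    by field; rewrite !gt_eqF.
  apply: ler_wpM2l.
    by apply: divr_ge0; [rewrite mulr_ge0// ltW|rewrite exprn_ge0// ltW].
  have s4 : s ^+ 2 <= s ^+ 4.
    have : 1 <= s ^+ 2 by rewrite exprn_ege1.
    have -> : s ^+ 4 = s ^+ 2 * s ^+ 2 by ring.
    by move: (s ^+ 2) => u u1; nra.
  by rewrite lef_pV2 ?posrE ?exprn_gt0.
apply: le_trans (lerD step (lexx _)) _.
have -> : B / ((1 - eta) * (s * q)) * (1 - delta) = B / (s * q) * ((1 - delta) / (1 - eta)).
  by field; rewrite !gt_eqF//; lra.
have c1 : (1 - delta) / (1 - eta) <= 1 - eta.
  by rewrite ler_pdivrMr /eta; nra.
have Bq0 : 0 < B / (s * q) by rewrite divr_gt0.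
have := ler_wpM2l (ltW Bq0) c1.
have : D' / n%:R <= eta * (B / (s * q)).
  apply: le_trans (_ : D' / (s * q) <= _).
    by rewrite ler_pM2l// lef_pV2.
  rewrite mulrA ler_pM2r ?invr_gt0//.
  have : eta * (2 * D' / delta) = D' by rewrite /eta; field; rewrite gt_eqF.
  have : 0 <= eta * (3 * N0%:R) by rewrite mulr_ge0 ?mulr_ge0// ltW.
  by rewrite /B; lra.
rewrite /D' mulrDl; lra.
Qed.

End rate.

(** * Geometric approximation of [p (n - i) / p n] *)

Section approx.
Context {R : realType}.
Local Notation r := (@rincr R).
Local Notation rt := (@sqrtn R).
Local Notation c0 := (@halfC R).
Local Notation x := (@pratio R).
Local Notation z := (@pgeo R).
Local Notation E := (@rincr_err R).

Lemma sqrt_sqrtn_sqr n : Num.sqrt (rt n) ^+ 2 = rt n.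
Proof. by rewrite sqr_sqrtr// sqrtn_ge0. Qed.

Lemma sqrt_sqrtn_ge1 n : (0 < n)%N -> 1 <= Num.sqrt (rt n).
Proof. by move=> n0; rewrite -[leLHS]sqrtr1 ler_wsqrtr// sqrtn_ge1. Qed.

(** Multiply the inequalities [1 - r <= exp (- r)]. The lower bound for [r q] is
    monotone in [q] beyond a threshold [J], hence at least its value at [n]; the
    indices below [J] cost a constant factor. *)
Lemma pratio_upper (B : R) : 0 < B ->
  (forall n, (0 < n)%N -> `|E n| <= B / (rt n * Num.sqrt (rt n))) ->
  exists (D : R) (N : nat), 0 < D /\ forall n i, (N <= n)%N -> (i <= n)%N ->
  x n i <= D * expR (- (i%:R * (c0 / rt n - B / (rt n * Num.sqrt (rt n))))).
Proof.
move=> B0 hE; have c00 := @halfC_gt0 R.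
pose g q := c0 / rt q - B / (rt q * Num.sqrt (rt q)).
pose J := (Num.truncn ((2 * B / c0) ^+ 4)).+1.
have gle q n : (J <= q)%N -> (q <= n)%N -> g n <= g q.
  move=> Jq qn; have q0 : (0 < q)%N by apply: leq_trans Jq.
  have n0 : (0 < n)%N by apply: leq_trans qn.
  have gE m : (0 < m)%N -> g m = c0 * (Num.sqrt (rt m))^-1 ^+ 2 - B * (Num.sqrt (rt m))^-1 ^+ 3.
    move=> m0; rewrite /g -[in LHS](sqrt_sqrtn_sqr m) sqrtr_sqr.
    have : 0 < Num.sqrt (rt m) by apply: lt_le_trans (sqrt_sqrtn_ge1 m0).
    by move=> h; rewrite (gtr0_norm h); field; rewrite gt_eqF.
  rewrite !gE//; set t := (Num.sqrt (rt q))^-1; set w := (Num.sqrt (rt n))^-1.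
  have sq0 : 0 < Num.sqrt (rt q) by apply: lt_le_trans (sqrt_sqrtn_ge1 q0).
  have sn0 : 0 < Num.sqrt (rt n) by apply: lt_le_trans (sqrt_sqrtn_ge1 n0).
  have w0 : 0 < w by rewrite invr_gt0.
  have wt : w <= t by rewrite lef_pV2 ?posrE// ler_wsqrtr// le_sqrtn.
  have tB : 2 * B * t <= c0.
    rewrite /t ler_pdivrMr// [leRHS]mulrC -ler_pdivrMr//.
    have b0 : 0 <= 2 * B / c0 by apply: divr_ge0; [rewrite mulr_ge0// ltW|exact: ltW].
    rewrite -(ler_pXn2r (isT : 0 < 4)%N) ?nnegrE ?sqrtr_ge0//.
    have -> : Num.sqrt (rt q) ^+ 4 = q%:R by rewrite (_ : 4 = 2 * 2)%N// exprM sqrt_sqrtn_sqr sqrtn_sqr.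
    have /andP[_] := truncn_itv (exprn_ge0 4 b0) => h; apply: le_trans (ltW h) _.
    by rewrite ler_nat.
  have -> : c0 * t ^+ 2 - B * t ^+ 3 = c0 * w ^+ 2 - B * w ^+ 3 +
      (t - w) * (c0 * (t + w) - B * (t ^+ 2 + t * w + w ^+ 2)) by ring.
  rewrite lerDl mulr_ge0//; first by lra.
  have : B * (t ^+ 2 + t * w + w ^+ 2) <= B * (2 * t * (t + w)).
    by rewrite ler_pM2l//; nra.
  have : 2 * B * t * (t + w) <= c0 * (t + w) by rewrite ler_wpM2r//; lra.
  lra.
have gc n : (0 < n)%N -> g n <= c0.
  move=> n0; have s1 := sqrtn_ge1 (R := R) n0; have s0 : 0 < rt n by lra.
  have : 0 <= B / (rt n * Num.sqrt (rt n)).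
    by apply: divr_ge0; [exact: ltW|rewrite mulr_ge0 ?sqrtr_ge0].
  have : c0 / rt n <= c0 by rewrite ler_pdivrMr// ler_peMr// ltW.
  by rewrite /g; lra.
(* Indices above [J], where the bounds multiply without loss. *)
have low n i : (J + i <= n)%N -> x n i <= expR (- (i%:R * g n)).
  elim: i => [|i IHi] Ji; first by rewrite pratio0 mul0r oppr0 expR0.
  have ni : (i < n)%N by lia.
  have Ji' : (J + i <= n)%N by lia.
  rewrite pratioS//; apply: le_trans (_ : expR (- (i%:R * g n)) * expR (- r (n - i)) <= _).
    apply: ler_pM; rewrite ?pratio_ge0 ?subr_ge0 ?rincr_le1 ?IHi//.
    exact: expR_ge1Dx.
  rewrite -expRD ler_expR -opprD lerN2 -natr1 mulrDl mul1r lerD2l.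
  have Jni : (J <= n - i)%N by lia.
  apply: le_trans (gle _ _ Jni (leq_subr _ _)) _.
  have ni0 : (0 < n - i)%N by rewrite subn_gt0.
  by have := hE _ ni0; rewrite ler_norml /E /g; lra.
exists (expR (J%:R * c0)), J; split=> [|n i Jn iN]; first exact: expR_gt0.
have n0 : (0 < n)%N by apply: leq_trans Jn.
have e1 : 1 <= expR (J%:R * c0).
  by rewrite -[leLHS]expR0 ler_expR mulr_ge0// ltW.
have [Ji|Ji] := leqP (J + i) n.
  apply: le_trans (low _ _ Ji) _; rewrite ler_peMl ?expR_ge0//.
apply: le_trans (_ : x n (n - J) <= _).
  by rewrite /x ler_pM2r ?invr_gt0 ?partR_gt0// le_partR//; lia.
have nJ : (J + (n - J) <= n)%N by lia.
apply: le_trans (low _ _ nJ) _; rewrite -expRD ler_expR.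
rewrite -/(g n) -lerBlDr opprK addrC -mulrBl -natrB; last by lia.
have [g0|g0] := leP 0 (g n); last first.
  apply: le_trans (_ : 0 <= _); last by rewrite mulr_ge0// ltW.
  by rewrite mulr_ge0_le0// ltW.
apply: ler_pM => //; last exact: gc.
by rewrite ler_nat; lia.
Qed.

(** Cut off at [n], in accordance with the vanishing second term of [p_atmostS]. *)
Definition pratio_ext (n i : nat) : R := if (i <= n)%N then x n i else 0.

(** For [2 * i <= n] by telescoping ([pratio_sub_pgeo]), each step having error
    [O (n^(-3/4) + j * n^(-3/2))]. For larger [i] both terms obey the exponential
    bound and the polynomial factor is bounded below. *)
Lemma pratio_near_pgeo : exists (B D : R) (N : nat), [/\ 0 < B, 0 < D &
  forall n i, (N <= n)%N ->
  `|pratio_ext n i - z n ^+ i| <= D * (i%:R / rt n + (i%:R / rt n) ^+ 2) / Num.sqrt (rt n) *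
     expR (- (i%:R * (c0 / rt n - B / (rt n * Num.sqrt (rt n)))))].
Proof.
have c00 := @halfC_gt0 R; have [B B0 hE] := @rincr_err_rate R.
have [D [N [D0 hx]]] := pratio_upper B0 hE.
pose D1 := D * expR c0 * (4 + 2 * B + 2 * c0).
have D10 : 0 < D1.
  apply: mulr_gt0; first by rewrite mulr_gt0 ?expR_gt0.
  lra.
pose D2 := 4 * (D + 1).
exists B, (D1 + D2), N.+1; split=> // [|n i Nn]; first by rewrite /D2; lra.
have n0 : (0 < n)%N by apply: leq_trans Nn.
have Nn' : (N <= n)%N by apply: ltnW.
set s := rt n; have s1 : 1 <= s by exact: sqrtn_ge1.
have s0 : 0 < s by lra.
have sn : s ^+ 2 = n%:R by exact: sqrtn_sqr.
set q := Num.sqrt s; have q1 : 1 <= q by exact: sqrt_sqrtn_ge1.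
have q0 : 0 < q by lra.
have qs : q ^+ 2 = s by exact: sqrt_sqrtn_sqr.
have sq0 : 0 < s * q by rewrite mulr_gt0.
set g := c0 / s - B / (s * q).
have gc : g <= c0.
  have : 0 <= B / (s * q) by rewrite divr_ge0 ?ltW.
  have : c0 / s <= c0 by rewrite ler_pdivrMr// ler_peMr// ltW.
  by rewrite /g; lra.
have zg j : z n ^+ j <= expR (- (j%:R * g)).
  rewrite pgeoX -/s ler_expR lerN2 mulrC ler_wpM2r//.
  have : 0 <= B / (s * q) by rewrite divr_ge0 ?ltW.
  by rewrite /g; lra.
have xg j : (j <= n)%N -> x n j <= D * expR (- (j%:R * g)) by move=> ?; exact: hx.
set e := expR (- (i%:R * g)); have e0 : 0 < e by exact: expR_gt0.
set u := i%:R / s; have u0 : 0 <= u by rewrite divr_ge0// ltW.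
have ui : i%:R = u * s by rewrite /u divfK// gt_eqF.
have T0 : 0 <= (u + u ^+ 2) / q * e.
  by rewrite mulr_ge0 ?(ltW e0)// divr_ge0 ?(ltW q0)// addr_ge0// exprn_ge0.
suff : `|pratio_ext n i - z n ^+ i| <= D1 * ((u + u ^+ 2) / q * e) \/
       `|pratio_ext n i - z n ^+ i| <= D2 * ((u + u ^+ 2) / q * e).
  have D20 : 0 < D2 by rewrite /D2; lra.
  have := mulr_ge0 (ltW D10) T0; have := mulr_ge0 (ltW D20) T0.
  have -> : (D1 + D2) * (u + u ^+ 2) / q * e = D1 * ((u + u ^+ 2) / q * e) + D2 * ((u + u ^+ 2) / q * e) by ring.
  by move=> ? ? [] ?; lra.
have [i2|i2] := leqP (2 * i) n; last first.
  right; have x_le : `|pratio_ext n i - z n ^+ i| <= (D + 1) * e.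
    have z0 : 0 <= z n ^+ i by rewrite exprn_ge0// ltW// pgeo_gt0.
    have := zg i; rewrite -/e => z1.
    have De : 0 < D * e by rewrite mulr_gt0.
    rewrite /pratio_ext; case: leqP => iN; last by rewrite sub0r normrN ger0_norm//; lra.
    have := xg _ iN; rewrite -/e; have := pratio_ge0 n i (R := R).
    by rewrite ler_norml; lra.
  apply: le_trans x_le _.
  have : 1 <= 4 * ((u + u ^+ 2) / q).
    have ir : s ^+ 2 <= 2 * i%:R by rewrite sn -natrM ler_nat ltnW.
    have us : s <= 2 * u by rewrite ui in ir; rewrite -(ler_pM2r s0); lra.
    have qls : q <= s by rewrite -qs expr2 ler_peMr// ltW.
    rewrite mulrA ler_pdivlMr// mul1r; nra.
  have De : 0 <= (D + 1) * e by rewrite mulr_ge0 ?(ltW e0)//; lra.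
  by move=> h; have := ler_wpM2l De h; rewrite /D2; lra.
left; have iN : (i <= n)%N by clear -i2; lia.
rewrite /pratio_ext iN pratio_sub_pgeo//; apply: le_trans (ler_norm_sum _ _ _) _.
pose W := D * expR c0 * e * ((4 + 2 * B) / (s * q) + 2 * c0 * i%:R / s ^+ 3).
apply: le_trans (_ : \sum_(0 <= j < i) W <= _); last first.
  rewrite sumr_const_nat subn0 -[W *+ i]mulr_natr /W /D1 ui.
  have De : 0 < D * expR c0 * e by rewrite mulr_gt0// mulr_gt0 ?expR_gt0.
  have -> : D * expR c0 * e * ((4 + 2 * B) / (s * q) + 2 * c0 * (u * s) / s ^+ 3) * (u * s)
    = D * expR c0 * e * ((4 + 2 * B) * (u / q) + 2 * c0 * (u ^+ 2 / s)).
    by field; rewrite !gt_eqF.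
  have -> : D * expR c0 * (4 + 2 * B + 2 * c0) * ((u + u ^+ 2) / q * e) =
    D * expR c0 * e * ((4 + 2 * B + 2 * c0) * (u / q + u ^+ 2 / q)) by ring.
  rewrite ler_pM2l//.
  have a1 : 0 <= u / q by rewrite divr_ge0// ltW.
  have a2 : 0 <= u ^+ 2 / q by rewrite divr_ge0 ?exprn_ge0// ltW.
  have a3 : u ^+ 2 / s <= u ^+ 2 / q.
    have qls : q <= s by rewrite -qs expr2 ler_peMr// ltW.
    by apply: ler_wpM2l; rewrite ?exprn_ge0// lef_pV2.
  have b1 := ler_wpM2l (ltW c00) a3; have b2 := mulr_ge0 (ltW B0) a2.
  have b3 := mulr_ge0 (ltW c00) a1; lra.
apply: ler_sum_nat => j /andP[_ ji].
have jn : (j <= n)%N by clear -ji iN; lia.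
have nj : (0 < n - j)%N by clear -ji iN; lia.
have j2 : (2 * j <= n)%N by clear -ji i2; lia.
have nj2 : (n <= 2 * (n - j))%N by clear -j2; lia.
rewrite normrM ger0_norm; last by rewrite mulr_ge0 ?pratio_ge0 ?exprn_ge0// ltW// pgeo_gt0.
apply: ler_pM => //.
- by rewrite mulr_ge0 ?pratio_ge0 ?exprn_ge0// ltW// pgeo_gt0.
- apply: le_trans (_ : D * expR (- (j%:R * g)) * expR (- ((i - j.+1)%:R * g)) <= _).
    by apply: ler_pM; rewrite ?pratio_ge0 ?exprn_ge0 ?(ltW (pgeo_gt0 _)) ?xg ?zg.
  rewrite -mulrA -mulrA ler_pM2l// -!expRD ler_expR natrB// -natr1; lra.
have t1 := @one_sub_pgeo R n n0; rewrite -/s -sn in t1.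
have t2 := @sqrtn_inv_diff_half R n j n0 j2; rewrite -/s in t2.
have t3 := hE _ nj; rewrite /E in t3.
have a0 : 0 < rt (n - j) by exact: sqrtn_gt0.
have as2 : s <= 2 * rt (n - j) /\ s ^+ 2 <= 2 * rt (n - j) ^+ 2.
  have : s ^+ 2 <= 2 * rt (n - j) ^+ 2.
    by rewrite sn sqrtn_sqr -natrM ler_nat.
  by move=> h; split=> //; nra.
have t4 : B / (rt (n - j) * Num.sqrt (rt (n - j))) <= 2 * B / (s * q).
  set a := rt (n - j) in a0 as2 *; set b := Num.sqrt a.
  have b0 : 0 < b by rewrite sqrtr_gt0.
  have b2 : b ^+ 2 = a by rewrite sqr_sqrtr// ltW.
  rewrite (_ : 2 * B / (s * q) = B / (s * q / 2)); last by field; rewrite !gt_eqF.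
  rewrite ler_pM2l// lef_pV2 ?posrE ?mulr_gt0 ?divr_gt0//.
  rewrite -(ler_pXn2r (isT : 0 < 2)%N) ?nnegrE ?(ltW (mulr_gt0 _ _)) ?divr_ge0 ?(ltW sq0)//.
  have -> : (s * q / 2) ^+ 2 = s ^+ 2 * s / 4 by rewrite -{3}qs; field.
  have -> : (a * b) ^+ 2 = a ^+ 2 * a by rewrite exprMn b2.
  have [h1 h2] := as2; have : s ^+ 2 * s <= (2 * a ^+ 2) * (2 * a).
    by apply: ler_pM => //; rewrite ?exprn_ge0 ?(ltW s0).
  lra.
have t5 : 4 / s ^+ 2 <= 4 / (s * q).
  have qls : q <= s by rewrite -qs expr2 ler_peMr// ltW.
  by rewrite ler_pM2l// lef_pV2 ?posrE ?exprn_gt0// expr2 ler_pM2l.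
have t6 : 2 * c0 * j%:R / s ^+ 3 <= 2 * c0 * i%:R / s ^+ 3.
  rewrite ler_pM2r ?invr_gt0 ?exprn_gt0// ler_pM2l; last by rewrite mulr_gt0.
  by rewrite ler_nat ltnW.
have t7 := ler_wpM2l (ltW c00) t2.
rewrite -[X in X * `|_|](gtr0_norm c00) -normrM mulrBr in t7.
have t8 : c0 * (2 * j%:R / s ^+ 3) = 2 * c0 * j%:R / s ^+ 3 by ring.
have -> : 1 - z n - r (n - j) = (1 - z n - c0 / s) - (r (n - j) - c0 / rt (n - j))
   - (c0 / rt (n - j) - c0 / s) by ring.
have := ler_normB (1 - z n - c0 / s - (r (n - j) - c0 / rt (n - j))) (c0 / rt (n - j) - c0 / s).
have := ler_normB (1 - z n - c0 / s) (r (n - j) - c0 / rt (n - j)).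
have -> : (4 + 2 * B) / (s * q) = 4 / (s * q) + 2 * B / (s * q) by ring.
lra.
Qed.

End approx.

(** * The limit distribution *)

Section limit.
Context {R : realType}.
Local Notation P := (@partR R).
Local Notation rt := (@sqrtn R).
Local Notation c0 := (@halfC R).
Local Notation z := (@pgeo R).

(** A power of [n] that dominates [ln n] and whose fourth power is the saving of
    [rincr_err_rate]. *)
Definition root16 (n : nat) : R := Num.sqrt (Num.sqrt (Num.sqrt (rt n))).

Lemma root16_ge1 n : (0 < n)%N -> 1 <= root16 n.
Proof.
move=> n0; rewrite /root16 -[leLHS]sqrtr1 ler_wsqrtr// -[leLHS]sqrtr1 ler_wsqrtr//.
exact: sqrt_sqrtn_ge1.
Qed.

Lemma sqrt_sqrtn_root16 n : Num.sqrt (rt n) = root16 n ^+ 4.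
Proof.
by rewrite /root16 (_ : 4 = 2 * 2)%N// exprM !sqr_sqrtr ?sqrtr_ge0.
Qed.

Lemma sqrtn_root16 n : rt n = root16 n ^+ 8.
Proof. by rewrite (_ : 8 = 4 * 2)%N// exprM -sqrt_sqrtn_root16 sqrt_sqrtn_sqr. Qed.

Lemma ln_le_root16 n : (0 < n)%N -> ln n%:R <= 16 * root16 n.
Proof.
move=> n0; have r0 : 0 < root16 n by apply: lt_le_trans (root16_ge1 n0).
rewrite -(sqrtn_sqr n) sqrtn_root16 -exprM (_ : 8 * 2 = 16)%N// lnXn// -[leLHS]mulr_natr [leLHS]mulrC.
by rewrite ler_pM2l// ltW// ln_sublinear.
Qed.

Lemma near_root16 (M : R) : \forall n \near \oo, M <= root16 n.
Proof.
exists (Num.truncn (`|M| ^+ 16)).+1 => //= n Mn.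
have n0 : (0 < n)%N by apply: leq_trans Mn.
have r0 : 0 <= root16 n by exact: sqrtr_ge0.
apply: le_trans (ler_norm _) _.
rewrite -(ler_pXn2r (isT : 0 < 16)%N) ?nnegrE//.
have -> : root16 n ^+ 16 = n%:R by rewrite (_ : 16 = 8 * 2)%N// exprM -sqrtn_root16 sqrtn_sqr.
have M16 : 0 <= `|M| ^+ 16 by rewrite exprn_ge0.
have /andP[_ h] := truncn_itv M16; apply: le_trans (ltW h) _.
by rewrite ler_nat.
Qed.

Lemma near_sqrtn (M : R) : \forall n \near \oo, M <= rt n.
Proof.
near=> n; have n0 : (0 < n)%N by near: n; exists 1%N.
apply: le_trans (_ : root16 n <= _); first by near: n; exact: near_root16.
by rewrite sqrtn_root16 ler_eXnr// root16_ge1.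
Unshelve. all: by end_near. Qed.

Lemma near_ln (M : R) : \forall n \near \oo, M <= ln (n%:R : R).
Proof.
exists (Num.truncn (expR M)).+1 => //= n Mn.
have n0 : 0 < n%:R :> R by rewrite ltr0n; apply: leq_trans Mn.
rewrite -(expRK M) ler_ln ?posrE ?expR_gt0//.
have /andP[_ h] := truncn_itv (expR_ge0 M); apply: le_trans (ltW h) _.
by rewrite ler_nat.
Qed.

Lemma cvg_inv_near (f : nat -> R) : (forall M, \forall n \near \oo, M <= f n) ->
  (fun n => (f n)^-1) @ \oo --> (0 : R).
Proof.
move=> hf; apply/cvgrPdist_le => e e0; near=> n.
have h : e^-1 <= f n by near: n; exact: hf.
have f0 : 0 < f n by apply: lt_le_trans h; rewrite invr_gt0.
rewrite sub0r normrN gtr0_norm ?invr_gt0// -[e]invrK lef_pV2 ?posrE ?invr_gt0//.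
Unshelve. all: by end_near. Qed.

(** The bases of the geometric sequences that dominate the error terms;
    the shift of the exponent by [2 / (sqrt n * ln n)] absorbs polynomial factors
    in [i / sqrt n] and is still harmless for [i] of order [sqrt n * ln n]. *)
Definition slow_geo (n : nat) : R := expR (- (c0 / rt n - 2 / (rt n * ln n%:R))).

(** With [u = i / sqrt n], the factor [u + u^2] is absorbed by [exp (u / ln n)] at
    the price of [(ln n)^2], which [n^(-1/4)] outweighs. *)
Lemma pratio_geometric : exists2 M : R, 0 < M &
  \forall n \near \oo, forall i, `|pratio_ext n i - z n ^+ i| <= M / root16 n * slow_geo n ^+ i.
Proof.
have [B [D [N [B0 D0 h]]]] := @pratio_near_pgeo R.
have [K K0 hK] : exists2 K : R, 0 < K & forall n, (0 < n)%N -> ln n%:R <= K * root16 n.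
  by exists 16; [lra|exact: ln_le_root16].
exists (3 * D * K ^+ 2) => [|]; first by rewrite mulr_gt0 ?exprn_gt0// mulr_gt0.
near=> n => i.
have n0 : (0 < n)%N by near: n; exists 1%N.
have Nn : (N <= n)%N by near: n; exists N.
have L1 : 1 <= ln (n%:R : R) by near: n; exact: near_ln.
have rB : B * K <= root16 n by near: n; exact: near_root16.
have r1 := root16_ge1 n0; have r0 : 0 < root16 n by lra.
have s0 : 0 < rt n by exact: sqrtn_gt0.
have LK := hK n n0.
apply: le_trans (h n i Nn) _.
set L := ln n%:R in L1 LK *; have L0 : 0 < L by lra.
set u := i%:R / rt n; have u0 : 0 <= u by rewrite divr_ge0// ltW.
have q0 : 0 < Num.sqrt (rt n) by rewrite sqrt_sqrtn_root16 exprn_gt0.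
have BL : B * L <= Num.sqrt (rt n).
  rewrite sqrt_sqrtn_root16; apply: le_trans (_ : B * (K * root16 n) <= _); first by rewrite ler_pM2l.
  rewrite mulrA; apply: le_trans (_ : root16 n * root16 n <= _); first by rewrite ler_pM2r.
  by rewrite -expr2 ler_weXn2l.
have e1 : expR (- (i%:R * (c0 / rt n - B / (rt n * Num.sqrt (rt n))))) <=
    slow_geo n ^+ i * expR (- (u / L)).
  rewrite /slow_geo -expRM_natl -expRD ler_expR -/L.
  have -> : i%:R * - (c0 / rt n - 2 / (rt n * L)) + - (u / L) =
     - (i%:R * (c0 / rt n)) + u / L by rewrite /u; field; rewrite !gt_eqF.
  have -> : - (i%:R * (c0 / rt n - B / (rt n * Num.sqrt (rt n)))) =
     - (i%:R * (c0 / rt n)) + u * (B / Num.sqrt (rt n)).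
    by rewrite /u; field; rewrite !gt_eqF.
  rewrite lerD2l ler_wpM2l// ler_pdivrMr// mulrC ler_pdivlMr//.
have e2 : (u + u ^+ 2) * expR (- (u / L)) <= 3 * L ^+ 2.
  have h1 := @pow_exp_le R L u 1 L0 u0; have h2 := @pow_exp_le R L u 2 L0 u0.
  have f1 : 1`!%:R = 1 :> R by []. have f2 : 2`!%:R = 2 :> R by [].
  rewrite f1 !expr1 in h1; rewrite f2 in h2.
  have : L <= L ^+ 2 by rewrite expr2 ler_peMr// ltW.
  by rewrite mulrDl; lra.
have y0 : 0 <= slow_geo n ^+ i by rewrite exprn_ge0// expR_ge0.
have uq : 0 <= D * (u + u ^+ 2) / Num.sqrt (rt n).
  by rewrite divr_ge0 ?(ltW q0)// mulr_ge0 ?(ltW D0)// addr_ge0// exprn_ge0.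
apply: le_trans (ler_wpM2l uq e1) _.
have -> : D * (u + u ^+ 2) / Num.sqrt (rt n) * (slow_geo n ^+ i * expR (- (u / L))) =
  D / Num.sqrt (rt n) * ((u + u ^+ 2) * expR (- (u / L))) * slow_geo n ^+ i by ring.
apply: ler_wpM2r => //.
have dq : 0 <= D / Num.sqrt (rt n) by rewrite divr_ge0 ?(ltW q0) ?(ltW D0).
apply: le_trans (ler_wpM2l dq e2) _.
have LL : L ^+ 2 <= K ^+ 2 * root16 n ^+ 2.
  rewrite -exprMn lerXn2r ?nnegrE//; [exact: ltW|exact: ltW (mulr_gt0 _ _)].
have c1 : 0 <= 3 * D / Num.sqrt (rt n) by rewrite divr_ge0 ?(ltW q0)// mulr_ge0// ltW.
have -> : D / Num.sqrt (rt n) * (3 * L ^+ 2) = 3 * D / Num.sqrt (rt n) * L ^+ 2 by ring.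
apply: le_trans (ler_wpM2l c1 LL) _; rewrite sqrt_sqrtn_root16.
have -> : 3 * D / root16 n ^+ 4 * (K ^+ 2 * root16 n ^+ 2) = 3 * D * K ^+ 2 / root16 n ^+ 2.
  by field; rewrite gt_eqF.
rewrite ler_pM2l ?mulr_gt0 ?exprn_gt0//.
by rewrite lef_pV2 ?posrE ?exprn_gt0// expr2 ler_peMr// ltW.
Unshelve. all: by end_near. Qed.

(** Peeling off the factors [1 - q^(jA)] one at a time, starting from all of [p]:
    each step costs a factor [1 + slow_geo^(jA)] in the error. *)
Lemma p_atmost_near (A n : nat) (e w v : R) : (0 < A)%N ->
  (forall i, `|pratio_ext n i - w ^+ i| <= e * v ^+ i) ->
  forall K, (K <= n)%N ->
  `|(p_atmost A K n)%:R / P n - \prod_(K.+1 <= j < n.+1) (1 - w ^+ (j * A))|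
  <= e * \prod_(K.+1 <= j < n.+1) (1 + v ^+ (j * A)).
Proof.
move=> A0 h K Kn.
pose a J i : R := if (i <= n)%N then (p_atmost A J (n - i))%:R / P n else 0.
pose Gw J := \prod_(J.+1 <= j < n.+1) (1 - w ^+ (j * A)).
pose Gv J := \prod_(J.+1 <= j < n.+1) (1 + v ^+ (j * A)).
suff : forall l, (l <= n)%N -> forall i, `|a (n - l)%N i - Gw (n - l)%N * w ^+ i| <= e * Gv (n - l)%N * v ^+ i.
  move=> /(_ _ (leq_subr K n) 0%N); rewrite subKn// /a leq0n subn0 !expr0 !mulr1.
  exact.
elim=> [_ i|l IHl ln i].
  rewrite subn0 /Gw /Gv !big_geq// mulr1 mul1r /a.
  have := h i; rewrite /pratio_ext /pratio; case: leqP => // iN.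
  by rewrite p_atmost_all// leq_subr.
have ln' : (l <= n)%N by exact: ltnW.
have {}IHl := IHl ln'.
have JE : (n - l = (n - l.+1).+1)%N by rewrite subnSK.
set J := (n - l.+1)%N in JE *; rewrite JE in IHl.
have Jn : (J.+1 < n.+1)%N by rewrite ltnS -JE leq_subr.
have aE : a J i = a J.+1 i - a J.+1 (i + J.+1 * A)%N.
  rewrite /a; case: (leqP i n) => iN; last first.
    by rewrite ifF ?subr0// leqNgt (leq_trans iN)// leq_addr.
  rewrite p_atmostS// natrD -leq_subRL//; case: ifP => _; last by rewrite addr0 subr0.
  by rewrite subnDA mulrDl addrK.
have GwE : Gw J = (1 - w ^+ (J.+1 * A)) * Gw J.+1 by rewrite /Gw big_ltn.
have GvE : Gv J = (1 + v ^+ (J.+1 * A)) * Gv J.+1 by rewrite /Gv big_ltn.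
rewrite aE GwE GvE.
have -> : a J.+1 i - a J.+1 (i + J.+1 * A)%N - (1 - w ^+ (J.+1 * A)) * Gw J.+1 * w ^+ i
  = (a J.+1 i - Gw J.+1 * w ^+ i) - (a J.+1 (i + J.+1 * A)%N - Gw J.+1 * w ^+ (i + J.+1 * A)).
  by rewrite exprD; ring.
apply: le_trans (ler_normB _ _) _; apply: le_trans (lerD (IHl i) (IHl _)) _.
by rewrite exprD le_eqVlt; apply/orP; left; apply/eqP; ring.
Qed.

Lemma geo_tail (w : R) K n : w != 1 -> (K <= n)%N ->
  \sum_(K.+1 <= j < n.+1) w ^+ j = w ^+ K.+1 * (1 - w ^+ (n - K)) / (1 - w).
Proof.
move=> w1 Kn; have w10 : 1 - w != 0 by rewrite subr_eq0 eq_sym.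
rewrite -{1}(subnKC Kn); elim: (n - K)%N => [|l IHl].
  by rewrite addn0 big_geq// expr0 subrr mulr0 mul0r.
rewrite addnS big_nat_recr/=; last by rewrite ltnS leq_addr.
by rewrite IHl -addSn exprD !exprS; field.
Qed.

(** The lower bound is [1 - u >= exp (- (1 + 2 * t) * u)] for [u <= t <= 1/2]. *)
Lemma prod_one_sub_bounds (f : nat -> R) a b t : 0 <= t <= 2^-1 ->
  (forall j, (a <= j < b)%N -> 0 <= f j <= t) ->
  expR (- ((1 + 2 * t) * \sum_(a <= j < b) f j)) <= \prod_(a <= j < b) (1 - f j)
    <= expR (- \sum_(a <= j < b) f j).
Proof.
move=> /andP[t0 t1] hf; rewrite -mulrN -sumrN big_distrr /= !expR_sum.
apply/andP; split; rewrite !big_nat; apply: ler_prod => j jab;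
  have /andP[f0 ft] := hf j jab; apply/andP; split; rewrite ?expR_ge0//.
- set u := f j in f0 ft *; rewrite mulrN expRN.
  have h : 1 <= (1 - u) * expR ((1 + 2 * t) * u).
    have h := expR_ge1Dx ((1 + 2 * t) * u); have u1 : 0 < 1 - u by lra.
    apply: le_trans (_ : (1 - u) * (1 + (1 + 2 * t) * u) <= _); last by rewrite ler_pM2l.
    have : 0 <= u * (2 * t - (1 + 2 * t) * u) by rewrite mulr_ge0//; nra.
    lra.
  by rewrite -[leLHS]mul1r ler_pdivrMr ?expR_gt0.
- lra.
- exact: expR_ge1Dx.
Qed.

Lemma p_le_atmost (kk : R) A n : 0 <= kk -> p_le kk A n = p_atmost A (Num.truncn kk) n.
Proof.
by move=> k0; rewrite p_le_count; apply: eq_count => s; rewrite truncn_ge_nat.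
Qed.

Lemma expR_half_ln n : (0 < n)%N -> expR (- (ln n%:R / 2)) = (rt n)^-1.
Proof.
move=> n0; rewrite expRN; congr (_^-1).
apply/eqP; rewrite -(@eqrXn2 _ 2) ?expR_ge0 ?sqrtn_ge0//; apply/eqP.
rewrite sqrtn_sqr -expRM_natl (_ : 2%:R * (ln n%:R / 2) = ln n%:R); last by lra.
by rewrite lnK// posrE ltr0n.
Qed.

(** A geometric sum: its first term is [T / s] up to a factor close to one, and
    [1 / (1 - exp (- a / s))] is [s / a] up to a bounded error. *)
Lemma exp_tail_bounds (a s kk T : R) (K n : nat) : 0 < a -> 0 < s ->
  2 * a <= s -> 2 / a <= s -> s ^+ 2 = n%:R -> (2 * K <= n)%N ->
  K%:R <= kk -> kk <= K%:R + 1 -> expR (- (a / s * kk)) = T / s ->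
  [/\ T / a * (1 - a / s) * (1 - 2 / (a * s)) <= \sum_(K.+1 <= j < n.+1) expR (- (a / s)) ^+ j,
      \sum_(K.+1 <= j < n.+1) expR (- (a / s)) ^+ j <= T / a + T / s &
      forall j, (K.+1 <= j)%N -> expR (- (a / s)) ^+ j <= T / s].
Proof.
move=> a0 s0 sa sa2 sn K2 K1 Kk TE.
have T0 : 0 < T.
  have : 0 < T / s by rewrite -TE expR_gt0.
  by rewrite pmulr_lgt0// invr_gt0.
have KN : (K <= n)%N by clear -K2; lia.
have nK : n%:R <= 2 * (n - K)%:R :> R by rewrite -natrM ler_nat; clear -K2; lia.
have vi : (a / s)^-1 = s / a by rewrite invf_div.
have v0 : 0 < a / s by rewrite divr_gt0.
have v1 : a / s <= 2^-1 by rewrite ler_pdivrMr//; lra.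
have vs : a / s * s ^+ 2 = a * s by field; rewrite gt_eqF.
move: (a / s) TE vi v0 v1 vs => v TE vi v0 v1 vs.
have w1 := expRN_lt1 v0; have w0 := expR_gt0 (- v).
have wge : 1 - v <= expR (- v) by exact: expR_ge1Dx.
have top : expR (- v) ^+ K.+1 <= T / s.
  by rewrite -TE -expRnat ler_expR lerN2 ler_pM2l// -natr1.
have tl : T / s * (1 - v) <= expR (- v) ^+ K.+1.
  apply: le_trans (_ : T / s * expR (- v) <= _).
    by rewrite ler_pM2l ?divr_gt0.
  rewrite -TE -expRD -expRnat ler_expR -natr1.
  by rewrite -opprD lerN2 mulrDr mulr1 lerD2r ler_pM2l.
have wn : expR (- v) ^+ (n - K) <= 2 / (a * s).
  have gl : a * s / 2 <= v * (n - K)%:R.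
    rewrite -sn in nK; have := ler_wpM2l (ltW v0) nK.
    by rewrite vs; lra.
  rewrite -expRnat; move: (v * (n - K)%:R) gl => g gl.
  have g0 : 0 < g by apply: lt_le_trans gl; rewrite divr_gt0 ?mulr_gt0.
  rewrite expRN -invf_div lef_pV2 ?posrE ?expR_gt0 ?divr_gt0 ?mulr_gt0//.
  by apply: le_trans gl _; have := expR_ge1Dx g; lra.
have inv := inv_one_sub_exp v0.
rewrite geo_tail ?lt_eqF//.
move: (expR (- v)) w0 w1 wge top tl wn inv => w w0 w1 wge top tl wn inv.
have t0 : 0 < w ^+ K.+1 by rewrite exprn_gt0.
have tn0 : 0 <= w ^+ (n - K) by rewrite exprn_ge0// ltW.
have tn1 : w ^+ (n - K) <= 1 by rewrite exprn_ile1 ?ltW.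
have i0 : 0 < (1 - w)^-1 by rewrite invr_gt0 subr_gt0.
have Ts : 0 < T / s by rewrite divr_gt0.
split.
- have wi : v^-1 <= (1 - w)^-1 by rewrite lef_pV2 ?posrE ?subr_gt0//; lra.
  have d1 : 2 / (a * s) <= 1.
    by rewrite ler_pdivrMr ?mulr_gt0// mul1r; move: sa2; rewrite ler_pdivrMr// mulrC.
  have -> : T / a * (1 - v) * (1 - 2 / (a * s)) =
     (T / s * (1 - v)) * (1 - 2 / (a * s)) * v^-1.
    by rewrite vi; field; rewrite !gt_eqF.
  move: (2 / (a * s)) d1 wn => d2 d1 wn.
  have h0 : 0 <= T / s * (1 - v) by apply: mulr_ge0; [exact: ltW|lra].
  apply: ler_pM => //; [by apply: mulr_ge0 => //; lra|by rewrite invr_ge0 ltW|].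
  by apply: ler_pM => //; lra.
- apply: le_trans (_ : T / s * (1 + s / a) <= _).
    rewrite -vi; apply: ler_pM => //; [|exact: ltW|].
      by apply: mulr_ge0; [exact: ltW|lra].
    by apply: le_trans top; rewrite ler_piMr ?(ltW t0)// gerBl.
  by rewrite le_eqVlt; apply/orP; left; apply/eqP; field; rewrite !gt_eqF.
- move=> j Kj; apply: le_trans top.
  by rewrite ler_wiXn2l ?ltW.
Qed.

Section asymptotics.
Context (A : nat) (A0 : (0 < A)%N) (X : R).

Let a : R := c0 * A%:R.
Let Lam : R := expR (- (a * X)).
Let kn (n : nat) : R := k A n X.
Let K (n : nat) : nat := Num.truncn (kn n).

Local Lemma a_gt0 : 0 < a. Proof. by rewrite mulr_gt0 ?halfC_gt0// ltr0n. Qed.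

Lemma knE n : kn n = rt n * (ln n%:R / (2 * a) + X).
Proof.
rewrite /kn /k (_ : C = 2 * c0 :> R); last by rewrite /c0; lra.
rewrite -/(rt n) /a; have := @halfC_gt0 R; have : 0 < A%:R :> R by rewrite ltr0n.
by move: (A%:R : R) c0 => b c b0 c1; field; rewrite !gt_eqF.
Qed.

Lemma near_K : \forall n \near \oo, [/\ 0 <= kn n, (2 * K n <= n)%N,
  (K n)%:R <= kn n & kn n <= (K n)%:R + 1].
Proof.
have a0 := a_gt0.
near=> n; have n0 : (0 < n)%N by near: n; exists 1%N.
have s0 : 0 < rt n by exact: sqrtn_gt0.
have k0 : 0 <= kn n.
  rewrite knE mulr_ge0 ?(ltW s0)//.
  have : - X * (2 * a) <= ln n%:R by near: n; exact: near_ln.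
  have a20 : 0 < 2 * a by rewrite mulr_gt0.
  rewrite -(ler_pdivlMr _ _ a20); lra.
have /andP[K1 K2] := truncn_itv k0; rewrite -/(K n) in K1 K2.
split => //; last by rewrite natr1 ltW.
rewrite -(ler_nat R) natrM -(sqrtn_sqr n).
suff : kn n <= rt n * (rt n / 2) by lra.
rewrite knE ler_pM2l//.
have r1 := root16_ge1 n0; have LK := ln_le_root16 n0.
have rs : root16 n ^+ 2 <= rt n by rewrite sqrtn_root16 ler_weXn2l.
have r4 : 4 * X <= root16 n by near: n; exact: near_root16.
have r32 : 32 / a <= root16 n by near: n; exact: near_root16.
have : ln n%:R / (2 * a) <= 8 / a * root16 n.
  rewrite (_ : 8 / a * root16 n = 16 * root16 n / (2 * a)); last by field; rewrite gt_eqF.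
  by rewrite ler_pM2r// invr_gt0 mulr_gt0.
have : 8 / a * root16 n <= root16 n ^+ 2 / 4.
  have -> : root16 n ^+ 2 / 4 = root16 n / 4 * root16 n by rewrite expr2; lra.
  by rewrite ler_pM2r; lra.
have : 4 * X <= root16 n ^+ 2 by apply: le_trans r4 _; rewrite expr2 ler_peMr//; lra.
by rewrite (_ : rt n / 2 = rt n / 4 + rt n / 4); lra.
Unshelve. all: by end_near. Qed.

Lemma pgeoX_mul n j : z n ^+ (j * A) = expR (- (a / rt n)) ^+ j.
Proof.
rewrite pgeoX -expRnat; congr expR; rewrite natrM /a; lra.
Qed.

(** This is where the choice of [k] matters: its logarithmic part turns the
    geometric weight at [k] into [1 / sqrt n], its linear part into [Lam]. *)
Lemma expR_kn n : (0 < n)%N -> expR (- (a / rt n * kn n)) = Lam / rt n.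
Proof.
move=> n0; have s0 : 0 < rt n by exact: sqrtn_gt0.
rewrite -[in RHS](expR_half_ln n0) /Lam -expRD knE; congr expR.
by field; rewrite !gt_eqF// a_gt0.
Qed.

Lemma sum_pgeo_bounds : \forall n \near \oo,
  [/\ Lam / a * (1 - a / rt n) * (1 - 2 / (a * rt n)) <= \sum_((K n).+1 <= j < n.+1) z n ^+ (j * A),
      \sum_((K n).+1 <= j < n.+1) z n ^+ (j * A) <= Lam / a + Lam / rt n &
      forall j, ((K n).+1 <= j)%N -> z n ^+ (j * A) <= Lam / rt n].
Proof.
near=> n; have n0 : (0 < n)%N by near: n; exists 1%N.
have s0 : 0 < rt n by exact: sqrtn_gt0.
have [k0 K2 K1 Kk] : [/\ 0 <= kn n, (2 * K n <= n)%N, (K n)%:R <= kn n & kn n <= (K n)%:R + 1].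
  by near: n; exact: near_K.
have sa : 2 * a <= rt n by near: n; exact: near_sqrtn.
have sa2 : 2 / a <= rt n by near: n; exact: near_sqrtn.
have [S1 S2 S3] := exp_tail_bounds a_gt0 s0 sa sa2 (sqrtn_sqr n) K2 K1 Kk (expR_kn n0).
rewrite (eq_bigr (fun j => expR (- (a / rt n)) ^+ j)) => [|j _]; last exact: pgeoX_mul.
by split=> // j Kj; rewrite pgeoX_mul; exact: S3.
Unshelve. all: by end_near. Qed.

(** At an exponent of order [sqrt n * ln n] the shift [2 / (sqrt n * ln n)] changes
    [slow_geo] only by a bounded factor. *)
Lemma prod_slow_geo_bounded : exists2 M : R, 0 < M & \forall n \near \oo,
  \prod_((K n).+1 <= j < n.+1) (1 + slow_geo n ^+ (j * A)) <= M.
Proof.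
have a0 := a_gt0; have c00 := @halfC_gt0 R.
have A0r : 0 < A%:R :> R by rewrite ltr0n.
pose M1 := a * `|X| + c0^-1 + 2 * A%:R * `|X|.
pose M2 := expR M1 * (1 + 2 / a).
exists (expR M2); first exact: expR_gt0.
near=> n; have n0 : (0 < n)%N by near: n; exists 1%N.
have s1 : 1 <= rt n by exact: sqrtn_ge1.
have s0 : 0 < rt n by lra.
have [k0 K2 K1 Kk] : [/\ 0 <= kn n, (2 * K n <= n)%N, (K n)%:R <= kn n & kn n <= (K n)%:R + 1].
  by near: n; exact: near_K.
have KN : (K n <= n)%N by clear -K2; lia.
have L1 : 1 <= ln (n%:R : R) by near: n; exact: near_ln.
have L4 : 4 / c0 <= ln (n%:R : R) by near: n; exact: near_ln.
set L := ln n%:R in L1 L4; have L0 : 0 < L by lra.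
pose v := a / rt n - 2 * A%:R / (rt n * L).
have v2 : a / (2 * rt n) <= v.
  have : 2 * A%:R / (rt n * L) <= a / (2 * rt n).
    rewrite (_ : a / (2 * rt n) = 2 * A%:R / (rt n * (4 / c0))); last first.
      by rewrite /a; field; rewrite !gt_eqF.
    rewrite ler_pM2l ?mulr_gt0// lef_pV2 ?posrE ?mulr_gt0 ?invr_gt0//.
    by rewrite ler_pM2l.
  have h2 : a / (2 * rt n) + a / (2 * rt n) = a / rt n by field; rewrite gt_eqF.
  by move=> h1; rewrite /v lerBrDr -h2 lerD2l.
have vh0 : 0 < a / (2 * rt n) by rewrite divr_gt0// mulr_gt0.
have v0 : 0 < v by lra.
have yE j : slow_geo n ^+ (j * A) = expR (- v) ^+ j.
  rewrite /slow_geo -!expRM_natl -/L natrM; congr expR; rewrite /v /a; field; rewrite !gt_eqF//.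
apply: le_trans (_ : expR (\sum_((K n).+1 <= j < n.+1) expR (- v) ^+ j) <= _).
  rewrite expR_sum !big_nat; apply: ler_prod => j _; rewrite yE.
  by rewrite addr_ge0 ?exprn_ge0 ?expR_ge0//= expR_ge1Dx.
rewrite ler_expR geo_tail ?lt_eqF ?expRN_lt1//.
have w1 := expRN_lt1 v0; have w0 := expR_gt0 (- v).
have top : expR (- v) ^+ (K n).+1 <= expR M1 / rt n.
  rewrite -(expR_half_ln n0) -expRD -expRnat ler_expR.
  apply: le_trans (_ : - (v * kn n) <= _).
    by rewrite lerN2 ler_pM2l// -natr1.
  have -> : v * kn n = L / 2 + (a * X - c0^-1 - 2 * A%:R * (X / L)).
    by rewrite knE /v -/L /a; field; rewrite !gt_eqF.
  rewrite -/L; have XL : `|X / L| <= `|X|.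
    by rewrite normrM normfV (gtr0_norm L0) ler_pdivrMr// ler_peMr.
  have aX : - (a * X) <= a * `|X|.
    by rewrite -mulrN ler_pM2l// -normrN ler_norm.
  have AX : 2 * A%:R * (X / L) <= 2 * A%:R * `|X|.
    by rewrite ler_pM2l ?mulr_gt0// (le_trans (ler_norm _)).
  have ci : 0 < c0^-1 by rewrite invr_gt0.
  by rewrite /M1; lra.
have t0 : 0 < expR (- v) ^+ (K n).+1 by rewrite exprn_gt0.
have iv : (1 - expR (- v))^-1 <= rt n * (1 + 2 / a).
  apply: le_trans (inv_one_sub_exp v0) _.
  have : v^-1 <= (a / (2 * rt n))^-1 by rewrite lef_pV2 ?posrE.
  rewrite invf_div; have -> : rt n * (1 + 2 / a) = rt n + 2 * rt n / a by ring.
  by move=> h; apply: lerD.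
rewrite /M2 (_ : expR M1 * (1 + 2 / a) = expR M1 / rt n * (rt n * (1 + 2 / a))); last first.
  by field; rewrite !gt_eqF.
apply: ler_pM => //.
- by rewrite mulr_ge0 ?(ltW t0)// subr_ge0 exprn_ile1 ?ltW.
- by rewrite invr_ge0 subr_ge0 ltW.
- by apply: le_trans top; rewrite ler_piMr ?(ltW t0)// gerBl exprn_ge0// ltW.
Unshelve. all: by end_near. Qed.

(** By [p_atmost_near] the ratio is within [O (1 / root16 n)] of the product of the
    [1 - z n ^+ (j * A)], and this product is squeezed between exponentials of the
    geometric sums of [sum_pgeo_bounds]. *)
Lemma p_le_cvg :
  (fun n => (p_le (k A n X) A n)%:R / P n) @ \oo --> expR (- (Lam / a)).
Proof.
have a0 := a_gt0; have Lam0 : 0 < Lam by exact: expR_gt0.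
have [M M0 hM] := pratio_geometric; have [M' M'0 hM'] := prod_slow_geo_bounded.
have cs := cvg_inv_near near_sqrtn; have cr := cvg_inv_near near_root16.
pose lo n : R := expR (- ((1 + 2 * (Lam / rt n)) * (Lam / a + Lam / rt n))) - M * M' / root16 n.
pose hi n : R := expR (- (Lam / a * (1 - a / rt n) * (1 - 2 / a / rt n))) + M * M' / root16 n.
apply: (@squeeze_cvgr _ _ _ _ lo hi).
- near=> n; have n0 : (0 < n)%N by near: n; exists 1%N.
  have s0 : 0 < rt n by exact: sqrtn_gt0.
  have r0 : 0 < root16 n by apply: lt_le_trans (root16_ge1 n0).
  have [k0 K2 _ _] : [/\ 0 <= kn n, (2 * K n <= n)%N, (K n)%:R <= kn n & kn n <= (K n)%:R + 1].
    by near: n; exact: near_K.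
  have KN : (K n <= n)%N by clear -K2; lia.
  have hx : forall i, `|pratio_ext n i - z n ^+ i| <= M / root16 n * slow_geo n ^+ i.
    by near: n.
  have hy : \prod_((K n).+1 <= j < n.+1) (1 + slow_geo n ^+ (j * A)) <= M' by near: n.
  have [S1 S2 S3] : [/\ Lam / a * (1 - a / rt n) * (1 - 2 / (a * rt n)) <=
       \sum_((K n).+1 <= j < n.+1) z n ^+ (j * A),
      \sum_((K n).+1 <= j < n.+1) z n ^+ (j * A) <= Lam / a + Lam / rt n &
      forall j, ((K n).+1 <= j)%N -> z n ^+ (j * A) <= Lam / rt n].
    by near: n; exact: sum_pgeo_bounds.
  have sL : 2 * Lam <= rt n by near: n; exact: near_sqrtn.
  rewrite p_le_atmost -/(kn n)// -/(K n).
  have := p_atmost_near A0 hx KN.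
  have t2 : 0 <= Lam / rt n <= 2^-1.
    apply/andP; split; first exact: ltW (divr_gt0 _ _).
    by rewrite ler_pdivrMr// [leRHS]mulrC ler_pdivlMr// [leLHS]mulrC.
  have hf j : ((K n).+1 <= j < n.+1)%N -> 0 <= z n ^+ (j * A) <= Lam / rt n.
    by move=> /andP[Kj _]; rewrite S3// exprn_ge0// ltW// pgeo_gt0.
  have /andP[G1 G2] := prod_one_sub_bounds t2 hf.
  set Q := _ / P n; set G := \prod_(_ <= j < _) (1 - _) in G1 G2 *.
  have e1 : M / root16 n * \prod_((K n).+1 <= j < n.+1) (1 + slow_geo n ^+ (j * A)) <= M * M' / root16 n.
    rewrite [leRHS]mulrAC ler_pM2l// divr_gt0//.
  move=> h; have {}h := le_trans h e1; rewrite ler_norml in h.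
  set S := \sum_(_ <= j < _) _ in S1 S2 G1 G2.
  have G3 : G <= expR (- (Lam / a * (1 - a / rt n) * (1 - 2 / a / rt n))).
    apply: le_trans G2 _; rewrite ler_expR lerN2; apply: le_trans S1.
    by rewrite -[2 / a / rt n]mulrA -invfM.
  have G4 : expR (- ((1 + 2 * (Lam / rt n)) * (Lam / a + Lam / rt n))) <= G.
    apply: le_trans G1; rewrite ler_expR lerN2 ler_wpM2l//.
    by have /andP[h1 _] := t2; lra.
  by rewrite /lo /hi; lra.
- rewrite /lo (_ : expR (- (Lam / a)) = expR (- ((1 + 2 * (Lam * 0)) * (Lam / a + Lam * 0))) - M * M' * 0); last first.
    by rewrite !mulr0 !addr0 mul1r subr0.
  apply: cvgB; last by apply: cvgMr.
  apply: continuous_cvg; first exact: continuous_expR.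
  apply: cvgN; apply: cvgM; apply: cvgD; (try exact: cvg_cst); last exact: cvgMr.
  by apply: cvgMr; exact: cvgMr.
- rewrite /hi (_ : expR (- (Lam / a)) =
     expR (- (Lam / a * (1 - a * 0) * (1 - 2 / a * 0))) + M * M' * 0); last first.
    by rewrite !mulr0 !subr0 !mulr1 addr0.
  apply: cvgD; last by apply: cvgMr.
  apply: continuous_cvg; first exact: continuous_expR.
  apply: cvgN; apply: cvgM; first apply: cvgMr; apply: cvgB; (try exact: cvg_cst); exact: cvgMr.
Unshelve. all: by end_near. Qed.

End asymptotics.
End limit.

Theorem theorem1p2 (R : realType) (A : nat) (hA : (2 <= A)%N) (x : R) :
  (fun n : nat => (p_le (k A n x) A n)%:R / (p n)%:R : R) @ \oo -->
    expR (- (2 / (A%:R * C)) * expR (- (1 / 2) * x * A%:R * C)).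
Proof.
have A0 : (0 < A)%N by apply: leq_trans hA.
have Ar : 0 < A%:R :> R by rewrite ltr0n.
have c00 := @halfC_gt0 R.
have CE : C = 2 * halfC :> R by rewrite /halfC; lra.
suff -> : - (2 / (A%:R * C)) * expR (- (1 / 2) * x * A%:R * C) =
    - (expR (- (halfC * A%:R * x)) / (halfC * A%:R)) by exact: (@p_le_cvg R A A0 x).
rewrite CE; have -> : - (1 / 2) * x * A%:R * (2 * halfC) = - (halfC * A%:R * x) by field.
by field; rewrite !gt_eqF.
Qed.
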